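(* Assume that, under model $M_j$ (true rank $k=j$), the top eigenvalues $\ell_1\ge\ell_2\ge\cdots$ of $X$ satisfy $\ell_i \to \psi_{\sigma}(\lambda_i)$ almost surely for $1 \le i \le j$ and $\ell_i \to 2\sigma$ almost surely for $j < i \le q$, where $\psi_\sigma(x)=x+\sigma^2/x$, and moreover that for any fixed $i>j$, $N^{2/3}(\ell_i - 2\sigma)$ converges in distribution to the GOE Tracy–Widom distribution of order $i-j$. Let $\delta_N$ be a sequence such that $\delta_N \to 0$ and $\delta_N \gg N^{-2/3}$. Then, under the assumption that $q$ and the eigenvalues of $A$ are fixed (do not change with $N$), $\hat{k}_{2 + \delta_N}$ is weakly consistent for $k$, i.e. $\mathbb{P}(\hat{k}_{2 + \delta_N} = k) \to 1$. This is true regardless of whether $\sigma$ is known or unknown.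
   Context: Spiked GOE model $X = A + \sigma G$, where $G$ is an $N\times N$ GOE matrix (symmetric, upper-diagonal entries i.i.d. $\mathcal N(0,1/N)$, diagonal entries i.i.d. $\mathcal N(0,2/N)$), and $A=\sum_{i=1}^k\lambda_i u_iu_i^\top$ is positive semi-definite of rank $k$ with $\lambda_1\ge\cdots\ge\lambda_k>\sigma$. Let $\ell_1\ge\cdots\ge\ell_N$ be the eigenvalues of $X$. Candidate models $M_0,\dots,M_q$, where under $M_j$ the rank is $j$. The generalised AIC scores are: for known $\sigma$, $\mathrm{GAIC}_\gamma(j) = -2\log C_N + \frac{N(N+1)}{2}\log\sigma^2 + \frac{N}{2\sigma^2}\sum_{i>j}\ell_i^2 + \gamma\big(Nj - \frac{j(j-1)}{2}\big)$; for unknown $\sigma$, with $\hat{\sigma}^2_j = \frac{1}{N+1}\sum_{i>j}\ell_i^2$, $\mathrm{GAIC}_\gamma(j) = -2\log C_N + \frac{N(N+1)}{2}\log\hat\sigma^2_j + \frac{N}{2\hat\sigma^2_j}\sum_{i>j}\ell_i^2 + \gamma\big(1+Nj - \frac{j(j-1)}{2}\big)$, where $C_N$ is a normalising constant. The estimator $\hat k_\gamma$ is the minimiser of $\mathrm{GAIC}_\gamma(j)$ over $j\in\{0,1,\dots,q\}$; here $\gamma=2+\delta_N$. *)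

(* Defs.v *)
From HB Require Import structures.
From mathcomp Require Import all_boot all_order all_algebra.
From mathcomp Require Import all_classical all_reals all_analysis.
Set Implicit Arguments.
Unset Strict Implicit.
Unset Printing Implicit Defensive.
Import Order.TTheory GRing.Theory Num.Theory.
Import numFieldTopology.Exports numFieldNormedType.Exports.
Local Open Scope classical_set_scope.
Local Open Scope ring_scope.

(* Indexing convention: eigenvalues are 0-based, l i = ell_{i+1} of the paper. *)

Definition is_ordered_spectrum (R : realType) (N : nat) (M : 'M[R]_N)
    (l : nat -> R) : Prop :=
  (forall i : nat, (i.+1 < N)%N -> l i.+1 <= l i) /\
  char_poly M = \prod_(i < N) ('X - (l i)%:P).

Definition spike_matrix (R : realType) (N k : nat) (lam : nat -> R)
    (u : nat -> 'cV[R]_N) : 'M[R]_N :=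
  \sum_(i < k) lam i *: (u i *m (u i)^T).

Definition orthonormal_family (R : realType) (N k : nat)
    (u : nat -> 'cV[R]_N) : Prop :=
  forall i j : nat, (i < k)%N -> (j < k)%N ->
    (u i)^T *m u j = ((i == j)%:R)%:M.

(* G is an N x N GOE matrix on the probability space (T, P): symmetric,
   upper-triangular (incl. diagonal) entries are random variables, mutually
   independent, off-diagonal ones N(0, 1/N), diagonal ones N(0, 2/N).
   (normal_prob m s is the normal law with mean m and standard deviation s.) *)
Definition GOE_matrix d (T : measurableType d) (R : realType)
    (P : probability T R) (N : nat) (G : T -> 'M[R]_N) : Prop :=
  (forall w, (G w)^T = G w) /\
  (forall i j : 'I_N, measurable_fun setT (fun w => G w i j)) /\
  (forall (i j : 'I_N) (B : set R), measurable B ->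
     P ((fun w => G w i j) @^-1` B) =
     normal_prob 0 (Num.sqrt ((if i == j then 2 else 1) / N%:R)) B) /\
  (forall B : 'I_N -> 'I_N -> set R, (forall i j, measurable (B i j)) ->
     P (\bigcap_(p in [set p : 'I_N * 'I_N | (p.1 <= p.2)%N])
          ((fun w => G w p.1 p.2) @^-1` B p.1 p.2)) =
     (\prod_(p : 'I_N * 'I_N | (p.1 <= p.2)%N)
          P ((fun w => G w p.1 p.2) @^-1` B p.1 p.2))%E).

Definition psi (R : realType) (sigma x : R) : R := x + sigma ^+ 2 / x.

(* sum_{i > j} ell_i^2  (1-based), i.e. sum_{j <= i < N} (l i)^2 (0-based) *)
Definition tail_sq (R : realType) (N j : nat) (l : nat -> R) : R :=
  \sum_(j <= i < N) (l i) ^+ 2.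

Definition npar (R : realType) (N j : nat) : R :=
  (N * j)%:R - j%:R * (j%:R - 1) / 2.

(* GAIC_gamma(j), sigma known; C is the normalising constant C_N *)
Definition GAIC_known (R : realType) (N : nat) (C sigma gamma : R)
    (l : nat -> R) (j : nat) : R :=
  - 2 * ln C + (N%:R * (N%:R + 1) / 2) * ln (sigma ^+ 2)
  + N%:R / (2 * sigma ^+ 2) * tail_sq N j l + gamma * npar R N j.

Definition sigma2_hat (R : realType) (N j : nat) (l : nat -> R) : R :=
  tail_sq N j l / (N%:R + 1).

Definition GAIC_unknown (R : realType) (N : nat) (C gamma : R)
    (l : nat -> R) (j : nat) : R :=
  - 2 * ln C + (N%:R * (N%:R + 1) / 2) * ln (sigma2_hat N j l)
  + N%:R / (2 * sigma2_hat N j l) * tail_sq N j l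
  + gamma * (1 + npar R N j).

Definition khat (R : realType) (q : nat) (F : nat -> R) : nat :=
  nat_of_ord [arg min_(j < (ord0 : 'I_q.+1)) F (nat_of_ord j)]%O.

Definition continuous_cdf (R : realType) (F : R -> R) : Prop :=
  {homo F : x y / x <= y} /\ continuous F /\
  F @ (-oo : set_system R) --> (0 : R) /\ F @ (+oo : set_system R) --> (1 : R).

(* Main.v *)
(** Write [S_j] for the sum of [l_i^2] over [i >= j].  Both scores satisfy
    [F j - F k >= N / (2 s_j) (S_j - S_k) + gamma (npar j - npar k)], where
    [s_j = sigma^2] when sigma is known and [s_j = S_j / (N + 1)] otherwise
    (there because [ln x >= 1 - 1 / x]).  Since [npar j - npar k] is
    [N (j - k) + O(1)], underfitting is excluded as soon as
    [l_i^2 > 2 gamma s_j] for the spikes, which holds because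
    [psi sigma x > 2 sigma], and overfitting as soon as
    [l_i^2 <= 2 s_j (gamma - delta / 2)] for [k <= i < j], which holds because the
    fluctuations of [l_i] around [2 sigma] are of order [N^(-2/3) << delta].

    For unknown sigma this requires [s_j = sigma^2 + o(delta)].  It comes from
    [S_0 = tr X^2], a sum of squares of independent Gaussian entries whose mean is
    [sigma^2 (N + 1) + O(1)] and whose variance is bounded in [N], so that
    Chebyshev's inequality gives an error [O(1) << N delta]. *)

Require Import Defs.
From HB Require Import structures.
From mathcomp Require Import all_boot all_order all_algebra.
From mathcomp Require Import all_classical all_reals all_analysis.
From mathcomp Require Import measurable_realfun ring lra.
Import Order.TTheory GRing.Theory Num.Theory.
Import numFieldTopology.Exports numFieldNormedType.Exports.
Local Open Scope classical_set_scope.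
Local Open Scope ring_scope.

(** * Traces of squares of symmetric matrices *)

(** Allows polynomial identities to be tested after substituting ['X^2], where the characteristic
    polynomial of a square factors. *)
Lemma comp_poly_inj {R : idomainType} (p : {poly R}) :
  (1 < size p)%N -> injective (fun q => q \Po p).
Proof.
move=> p1 q r /eqP; rewrite -subr_eq0 -comp_polyB comp_poly_eq0// subr_eq0.
by move/eqP.
Qed.

Lemma char_poly_sqr {R : idomainType} (n : nat) (M : 'M[R]_n) (l : nat -> R) :
  char_poly M = \prod_(i < n) ('X - (l i)%:P) ->
  char_poly (M *m M) = \prod_(i < n) ('X - (l i ^+ 2)%:P).
Proof.
(* [det (X^2 - M^2) = det (X - M) det (X + M)] *)
move=> ME; apply: (@comp_poly_inj _ 'X^2); first by rewrite size_polyXn.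
rewrite rmorph_prod/=.
have -> : \prod_(i < n) (('X - (l i ^+ 2)%:P) \Po 'X^2) =
    \prod_(i < n) ('X - (l i)%:P) * \prod_(i < n) ('X + (l i)%:P).
  rewrite -big_split/=; apply: eq_bigr => i _.
  by rewrite comp_polyB comp_polyX comp_polyC rmorphXn/= subr_sqr.
(* Up to the sign [(-1) ^+ n], this determinant is [char_poly M] with [- 'X] substituted for
   ['X]. *)
have MN : \det ('X%:M + map_mx polyC M) = \prod_(i < n) ('X + (l i)%:P).
  have : (char_poly M) \Po (- 'X) = (-1) ^+ n * \det ('X%:M + map_mx polyC M).
    rewrite -detZ /char_poly -det_map_mx; congr (\det _).
    apply/matrixP => i j; rewrite !mxE rmorphB/= comp_polyC rmorphMn/= comp_polyX.
    by rewrite mulN1r opprD mulNrn.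
  rewrite ME rmorph_prod/= => /(congr1 (fun p => (-1) ^+ n * p)).
  rewrite mulrA -exprMn mulrNN mulr1 expr1n mul1r => <-.
  have -> : (-1) ^+ n = \prod_(i < n) (-1 : {poly R}).
    by rewrite prodr_const card_ord.
  rewrite -big_split/=; apply: eq_bigr => i _.
  by rewrite comp_polyB comp_polyX comp_polyC mulN1r opprB addrC opprK.
rewrite -MN -ME /char_poly -det_mulmx -det_map_mx; congr (\det _).
rewrite mulmxDr !mulmxBl -scalar_mxM -map_mxM/= scalar_mxC subrKA.
apply/matrixP => i j; rewrite !mxE rmorphB/= comp_polyC rmorphMn/= comp_polyX.
by rewrite expr2.
Qed.

(** Both sides are minus the coefficient of degree [n - 1] in [char_poly (M *m M)], read once from
    the trace and once from the roots. Size 0 has no such coefficient and is treated apart. *)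
Lemma sum_sqr_eigenvalues {R : idomainType} (n : nat) (M : 'M[R]_n)
    (l : nat -> R) :
  char_poly M = \prod_(i < n) ('X - (l i)%:P) ->
  \sum_(0 <= i < n) l i ^+ 2 = \tr (M *m M).
Proof.
move=> /char_poly_sqr ME; case: n => [|n] in M ME *.
  by rewrite big_nil /mxtrace big_ord0.
have /(congr1 -%R) := char_poly_trace (M *m M) isT; rewrite opprK => <-.
rewrite ME -(big_mkord xpredT (fun i => 'X - (l i ^+ 2)%:P)).
rewrite -(big_map (fun i => l i ^+ 2) xpredT (fun x => 'X - x%:P)).
have := @coefPn_prod_XsubC _ [seq l i ^+ 2 | i <- index_iota 0 n.+1].
rewrite size_map size_iota => -> //.
by rewrite opprK big_map.
Qed.

Lemma mxtrace_sqr_sym {R : comPzRingType} (n : nat) (M : 'M[R]_n) :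
  M^T = M -> \tr (M *m M) = \sum_i \sum_j M i j ^+ 2.
Proof.
move=> MT; apply: eq_bigr => i _; rewrite mxE; apply: eq_bigr => j _.
by rewrite -[in X in _ * X]MT mxE expr2.
Qed.

(** Independence in a GOE matrix concerns the upper triangle only, so Frobenius norms have to be
    rewritten over it, off-diagonal entries counting twice. *)
Lemma sum_sym_matrix {R : pzSemiRingType} (n : nat) (f : 'I_n -> 'I_n -> R) :
  (forall i j, f i j = f j i) ->
  \sum_i \sum_j f i j =
  \sum_(p : 'I_n * 'I_n | (p.1 <= p.2)%N) (if p.1 == p.2 then 1 else 2) * f p.1 p.2.
Proof.
move=> fC; rewrite pair_big/= (bigID (fun p : 'I_n * 'I_n => (p.1 <= p.2)%N))/=.
have -> : \sum_(i : 'I_n * 'I_n | ~~ (i.1 <= i.2)%N) f i.1 i.2 =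
          \sum_(i : 'I_n * 'I_n | (i.1 < i.2)%N) f i.1 i.2.
  rewrite (reindex_inj (h := fun p : 'I_n * 'I_n => (p.2, p.1)))/=; last first.
    by move=> [a b] [c e] [-> ->].
  by apply: eq_big => [p|p _]; rewrite -?ltnNge.
rewrite [X in _ + X](_ : _ = \sum_(p : 'I_n * 'I_n | (p.1 <= p.2)%N)
    if (p.1 != p.2) then f p.1 p.2 else 0); last first.
  rewrite -big_mkcondr/=; apply: eq_bigl => p.
  by rewrite ltn_neqAle andbC.
rewrite -big_split/=; apply: eq_bigr => p _.
by case: eqP => /= _; rewrite ?addr0 ?mul1r // mulr_natl mulr2n.
Qed.

Lemma spike_matrix_sym {R : realType} (N k : nat) (lam : nat -> R)
  (u : nat -> 'cV[R]_N) : (spike_matrix k lam u)^T = spike_matrix k lam u.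
Proof.
rewrite /spike_matrix raddf_sum; apply: eq_bigr => i _ /=.
by rewrite linearZ/= trmx_mul trmxK.
Qed.

(** Orthonormality kills the cross terms of the trace of the square. The value does not depend on
    [N], so the spikes shift the trace by a bounded amount. *)
Lemma sum_sqr_spike_matrix {R : realType} (N k : nat) (lam : nat -> R)
    (u : nat -> 'cV[R]_N) :
  orthonormal_family k u ->
  \sum_i \sum_j spike_matrix k lam u i j ^+ 2 = \sum_(i < k) lam i ^+ 2.
Proof.
move=> uu; rewrite -mxtrace_sqr_sym ?spike_matrix_sym// /spike_matrix.
rewrite mulmx_suml raddf_sum/=; apply: eq_bigr => i _.
rewrite mulmx_sumr raddf_sum/= (bigD1 i)//= big1 ?addr0.
  rewrite -scalemxAl -scalemxAr -mulmxA (mulmxA (u i)^T) uu// eqxx mul1mx.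
  by rewrite !mxtraceZ mxtrace_mulC uu// eqxx mxtrace1 mulr1 expr2.
move=> j ji; rewrite -scalemxAl -scalemxAr -mulmxA (mulmxA (u i)^T) uu//.
rewrite eq_sym (inj_eq val_inj) (negbTE ji).
by rewrite raddf0 mul0mx mulmx0 !scaler0 mxtrace0.
Qed.

(** * Moments of the normal law *)

Section normal_law.
Context {R : realType}.
Local Notation mu := (@lebesgue_measure R).

(** The Radon-Nikodym derivative of the normal law and [normal_pdf] have the same integral over
    every measurable set, hence agree almost everywhere. *)
Lemma ge0_integral_normal_prob (m s : R) (f : R -> \bar R) :
  measurable_fun setT f -> (forall x, (0 <= f x)%E) ->
  (\int[normal_prob m s]_x f x = \int[mu]_x (f x * (normal_pdf m s x)%:E))%E.
Proof.
move=> mf f0.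
have dom := @normal_prob_dominates R m s.
rewrite -(Radon_Nikodym_SigmaFinite.change_of_variables dom)//.
apply: ae_eq_integral => //.
- apply: emeasurable_funM => //.
  exact: measurable_int (Radon_Nikodym_SigmaFinite.f_integrable _).
- apply: emeasurable_funM => //; apply/measurable_EFinP.
  exact: measurable_normal_pdf.
apply: ae_eqe_mul2l; apply: integral_ae_eq => //.
- exact: Radon_Nikodym_SigmaFinite.f_integrable.
- by apply/measurable_EFinP; exact: measurable_normal_pdf.
by move=> A AE mA; rewrite -Radon_Nikodym_SigmaFinite.f_integral.
Qed.

(** Completing the square: an exponential of a linear function moves the mean from 0 to [h]. *)
Lemma normal_fun_tilt (h s x : R) : s != 0 ->
  expR (h * x / s ^+ 2 - h ^+ 2 / (s ^+ 2 *+ 2)) * normal_fun 0 s x =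
  normal_fun h s x.
Proof.
by move=> s0; rewrite /normal_fun -expRD; congr expR; field.
Qed.

Lemma normal_fun_dilate (t s x : R) : s != 0 -> t != 0 ->
  expR (x ^+ 2 * (t ^+ 2 - s ^+ 2) / ((s * t) ^+ 2 *+ 2)) * normal_fun 0 s x =
  normal_fun 0 t x.
Proof.
move=> s0 t0; rewrite /normal_fun -expRD; congr expR; field.
by rewrite s0 t0.
Qed.

Lemma normal_peak_dilate (t s : R) : 0 < s -> 0 < t ->
  normal_peak s = t / s * normal_peak t.
Proof.
move=> s0 t0; rewrite /normal_peak -!mulrnAr.
rewrite (sqrtrM _ (sqr_ge0 s)) (sqrtrM _ (sqr_ge0 t)).
rewrite !sqrtr_sqr !gtr0_norm//; field; rewrite !gt_eqF//=.
by rewrite sqrtr_gt0 pmulrn_lgt0// pi_gt0.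
Qed.

Lemma integral_normal_tilt (h s : R) : s != 0 ->
  (\int[normal_prob 0 s]_x (expR (h * x / s ^+ 2 - h ^+ 2 / (s ^+ 2 *+ 2)))%:E
   = 1)%E.
Proof.
move=> s0; rewrite ge0_integral_normal_prob.
- rewrite -(integral_normal_pdf h s); apply: eq_integral => x _.
  rewrite -EFinM; congr (_%:E); rewrite !normal_pdfE// mulrCA.
  by rewrite normal_fun_tilt.
- apply/measurable_EFinP/measurableT_comp => //; apply: measurable_funB => //.
  apply: measurable_funM => //; exact: measurable_funM.
- by move=> x; rewrite lee_fin expR_ge0.
Qed.

(** The integrand times the density of N(0, s^2) is [t / s] times the density of N(0, t^2). This
    covers growing exponents ([t > s]) as well as decaying ones. *)
Lemma integral_normal_dilate (t s : R) : 0 < s -> 0 < t ->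
  (\int[normal_prob 0 s]_x
    (expR (x ^+ 2 * (t ^+ 2 - s ^+ 2) / ((s * t) ^+ 2 *+ 2)))%:E
   = (t / s)%:E)%E.
Proof.
move=> s0 t0; rewrite ge0_integral_normal_prob.
- transitivity (\int[mu]_x ((t / s)%:E * (normal_pdf 0 t x)%:E))%E.
    apply: eq_integral => x _.
    rewrite -!EFinM; congr (_%:E); rewrite !normal_pdfE ?gt_eqF// mulrCA.
    by rewrite normal_fun_dilate ?gt_eqF// (normal_peak_dilate t)// mulrA.
  rewrite ge0_integralZl.
  + by rewrite integral_normal_pdf mule1.
  + exact: measurableT.
  + by apply/measurable_EFinP; exact: measurable_normal_pdf.
  + by move=> x _; rewrite lee_fin normal_pdf_ge0.
  + by rewrite lee_fin divr_ge0 ?ltW.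
- apply/measurable_EFinP/measurableT_comp => //.
  apply: measurable_funM => //; apply: measurable_funM => //.
- by move=> x; rewrite lee_fin expR_ge0.
Qed.

End normal_law.

(* For the second moment [m] of N(0, s^2): the hypothesis below is the integral of
   [1 + y <= expR y] with [y] chosen so that tilting by [expR y] turns the density
   of N(0, s^2) into a multiple of that of N(0, t^2); let [t] tend to [s]. *)
Lemma second_moment_squeeze {R : realFieldType} (s m : R) : 0 < s -> 0 <= m ->
  (forall t, 0 < t -> 0 <= (t - s) * (2 * s * t ^+ 2 - m * (t + s))) ->
  m = s ^+ 2.
Proof.
move=> s0 m0 key.
apply/eqP; rewrite eq_le; apply/andP; split; rewrite leNgt; apply/negP => ms.
(* Each inequality is refuted by a test value of [t] at distance [e] from [s], on the side of the
   error. As [e] is a fixed fraction of the gap between [m] and [s ^+ 2], or less, the gap outweighs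
   the terms in [e] from expanding the hypothesis. *)
- pose e := Num.min s ((m - s ^+ 2) / (6 * s)).
  have e0 : 0 < e by rewrite lt_min s0 divr_gt0 ?subr_gt0 ?mulr_gt0.
  have es : e <= s by rewrite ge_min lexx.
  have em : e * (6 * s) <= m - s ^+ 2.
    by rewrite -ler_pdivlMr ?mulr_gt0// ge_min lexx orbT.
  have /key : 0 < s + e by rewrite addr_gt0.
  rewrite (_ : s + e - s = e); last by ring.
  rewrite pmulr_rge0// => H; nra.
- pose e := (s ^+ 2 - m) / (4 * s).
  have e0 : 0 < e by rewrite divr_gt0 ?subr_gt0 ?mulr_gt0.
  have em : e * (4 * s) = s ^+ 2 - m by rewrite /e divfK// gt_eqF// mulr_gt0.
  have es : e < s by nra.
  have /key : 0 < s - e by rewrite subr_gt0.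
  rewrite (_ : s - e - s = - e); last by ring.
  rewrite mulNr oppr_ge0 pmulr_rle0// => H; nra.
Qed.

(** * Integrability and affine functions under a probability measure *)

Section probability_integral.
Context {d} {T : measurableType d} {R : realType} (P : probability T R).

Lemma integrable_affine (a b : R) (f : T -> R) :
  P.-integrable setT (EFin \o f) ->
  P.-integrable setT (fun w => (a + b * f w)%:E).
Proof.
move=> fi.
apply: (@eq_integrable _ _ _ _ _ _
  (fun w => a%:E + b%:E * (f w)%:E)%E) => //.
apply: integrableD => //; first exact: finite_measure_integrable_cst.
exact: integrableZl.
Qed.

Lemma integral_affine (a b m : R) (f : T -> R) :
  P.-integrable setT (EFin \o f) -> (\int[P]_w (f w)%:E = m%:E)%E ->
  (\int[P]_w (a + b * f w)%:E = (a + b * m)%:E)%E.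
Proof.
move=> fi fm; under eq_integral do rewrite EFinD EFinM.
rewrite integralD//=; last 2 first.
- exact: finite_measure_integrable_cst.
- exact: integrableZl.
rewrite integralZl// fm integral_cst//.
rewrite (_ : a%:E * _ = a%:E)%E //.
by rewrite -[RHS]mule1; congr (_ * _)%E; exact: probability_setT.
Qed.

(** Domination by [1 + f ^+ 2], the constant being integrable because the total mass is finite. *)
Lemma integrable_of_sqr (f : T -> R) : measurable_fun setT f ->
  P.-integrable setT (fun w => (f w ^+ 2)%:E) -> P.-integrable setT (EFin \o f).
Proof.
move=> mf if2.
apply: (@le_integrable _ _ _ _ _ _ _ (fun w => (1 + 1 * f w ^+ 2)%:E)) => //.
- exact/measurable_EFinP.
- move=> w _; rewrite !abse_EFin lee_fin mul1r.
  rewrite [leRHS]ger0_norm ?addr_ge0 ?sqr_ge0//.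
  by have := sqr_ge0 (`|f w| - 1); have := real_normK (num_real (f w)); nra.
exact: integrable_affine.
Qed.

End probability_integral.

(** * Moments of a centred Gaussian random variable *)

Section gaussian_moments.
Context {d} {T : measurableType d} {R : realType} (P : probability T R).
Variables (X : T -> R) (s : R).
Hypothesis s_gt0 : 0 < s.
Hypothesis mX : measurable_fun setT X.
Hypothesis X_law : forall B, measurable B ->
  P (X @^-1` B) = normal_prob 0 s B.

Let ge0_integral_law (f : R -> \bar R) :
  measurable_fun setT f -> (forall x, (0 <= f x)%E) ->
  (\int[P]_w f (X w) = \int[normal_prob 0 s]_x f x)%E.
Proof.
move=> mf f0.
have mX' : measurable_fun setT (X : T -> measurableTypeR R) := mX.
pose Y : {mfun T >-> measurableTypeR R} :=
  HB.pack (X : T -> measurableTypeR R) (isMeasurableFun.Build _ _ _ _ _ mX').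
transitivity (\int[pushforward P Y]_x f x)%E.
  by rewrite ge0_integral_pushforward.
by apply: eq_measure_integral => A mA _; exact: X_law.
Qed.

Let measurable_comp_law (f : R -> R) :
  measurable_fun setT f -> measurable_fun setT (EFin \o (f \o X)).
Proof. by move=> mf; apply/measurable_EFinP/measurableT_comp. Qed.

Lemma gaussian_integral_tilt (h : R) :
  (\int[P]_w (expR (h * X w / s ^+ 2 - h ^+ 2 / (s ^+ 2 *+ 2)))%:E = 1)%E.
Proof.
rewrite -(@integral_normal_tilt R h s) ?gt_eqF//.
rewrite -ge0_integral_law//.
apply/measurable_EFinP/measurableT_comp => //; apply: measurable_funB => //.
by apply: measurable_funM => //; exact: measurable_funM.
Qed.

Lemma gaussian_integral_dilate (t : R) : 0 < t ->
  (\int[P]_w (expR (X w ^+ 2 * (t ^+ 2 - s ^+ 2) / ((s * t) ^+ 2 *+ 2)))%:E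
   = (t / s)%:E)%E.
Proof.
move=> t0; rewrite -(@integral_normal_dilate R t s)//.
rewrite -ge0_integral_law//.
by apply/measurable_EFinP/measurableT_comp => //; do 2 apply: measurable_funM => //.
Qed.

(* The exact constant is 3; this one comes from comparing with N(0, (2 s)^2)
   through [y ^ 2 / 4 <= expR y]. *)
Lemma gaussian_fourth_moment : (\int[P]_w (X w ^+ 4)%:E <= (57 * s ^+ 4)%:E)%E.
Proof.
have t0 : 0 < 2 * s by rewrite mulr_gt0.
(* The factor [2 * s / s] is the exponential integral given by [gaussian_integral_dilate] at
   [t = 2 * s]. *)
have -> : 57 * s ^+ 4 = (57 / 2 * s ^+ 4) * (2 * s / s) by field; rewrite gt_eqF.
have mE : measurable_fun setT (fun w => (expR (X w ^+ 2 *
    ((2 * s) ^+ 2 - s ^+ 2) / ((s * (2 * s)) ^+ 2 *+ 2)))%:E).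
  apply: (measurable_comp_law (fun x =>
    expR (x ^+ 2 * ((2 * s) ^+ 2 - s ^+ 2) / ((s * (2 * s)) ^+ 2 *+ 2)))).
  by apply: measurableT_comp => //; do 2 apply: measurable_funM => //.
rewrite EFinM -gaussian_integral_dilate// -ge0_integralZl//=; last first.
  by rewrite lee_fin mulr_ge0// exprn_ge0// ltW.
apply: ge0_le_integral => //.
- by move=> x _; rewrite lee_fin exprn_even_ge0.
- exact: (measurable_comp_law (fun x => x ^+ 4)).
- by apply: emeasurable_funM => //; exact: mE.
move=> w _; rewrite -EFinM lee_fin.
set y := X w ^+ 2 * _ / _.
have yE : X w ^+ 2 = 8 / 3 * s ^+ 2 * y by rewrite /y; field; rewrite gt_eqF.
have y0 : 0 <= y.
  by rewrite -(@pmulr_rge0 _ (8 / 3 * s ^+ 2)) -?yE ?sqr_ge0// mulr_gt0// exprn_gt0.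
have : (1 + y / 2) ^+ 2 <= expR y.
  rewrite -[in leRHS](@divfK _ 2 _ y)// expRM_natr.
  rewrite lerXn2r ?nnegrE ?expR_ge0 ?expR_ge1Dx//.
  by rewrite addr_ge0// divr_ge0.
move=> ey.
have -> : X w ^+ 4 = (64 / 9 * s ^+ 4) * y ^+ 2.
  by rewrite (exprM (X w) 2 2) yE; field.
have s4 : 0 <= s ^+ 4 by rewrite exprn_ge0// ltW.
rewrite (_ : 57 / 2 * s ^+ 4 * _ = s ^+ 4 * (57 / 2 * expR y)); last by ring.
rewrite (_ : 64 / 9 * s ^+ 4 * _ = s ^+ 4 * (64 / 9 * y ^+ 2)); last by ring.
(* From [(1 + y / 2) ^+ 2 <= expR y] comes [y ^+ 2 <= 4 * expR y], so the claim reduces to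
   [256 / 9 <= 57 / 2]; this is the origin of 57. *)
apply: ler_wpM2l => //; nra.
Qed.

Lemma gaussian_integrable_fourth : P.-integrable setT (fun w => (X w ^+ 4)%:E).
Proof.
apply/integrableP; split.
  by apply: (measurable_comp_law (fun x => x ^+ 4)).
under eq_integral => w _ do rewrite gee0_abs ?lee_fin ?exprn_even_ge0//.
exact: le_lt_trans gaussian_fourth_moment (ltry _).
Qed.

Lemma gaussian_integrable_sqr : P.-integrable setT (fun w => (X w ^+ 2)%:E).
Proof.
apply: (integrable_of_sqr P (fun w => X w ^+ 2)); first exact: measurable_funX.
by under eq_fun do rewrite -exprM; exact: gaussian_integrable_fourth.
Qed.

Lemma gaussian_integrable : P.-integrable setT (fun w => (X w)%:E).
Proof. exact: integrable_of_sqr gaussian_integrable_sqr. Qed.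

(* [1 + y <= expR y] where tilting by [expR y] translates the density by the mean
   [m] itself; integrating gives [m ^ 2 <= 0]. *)
Lemma gaussian_mean : (\int[P]_w (X w)%:E = 0)%E.
Proof.
have iX := gaussian_integrable.
have /fineK/esym mE := integrable_fin_num measurableT iX.
move: mE; set m := fine _ => mE; rewrite mE; congr (_%:E).
have s2 : 0 < s ^+ 2 by rewrite exprn_gt0.
have : (\int[P]_w (1 - m ^+ 2 / (s ^+ 2 *+ 2) + m / s ^+ 2 * X w)%:E <= 1)%E.
  rewrite -(gaussian_integral_tilt m); apply: le_integral => //.
  - exact: integrable_affine.
  - apply/integrableP; split.
      apply: (measurable_comp_law (fun x =>
        expR (m * x / s ^+ 2 - m ^+ 2 / (s ^+ 2 *+ 2)))).
      apply: measurableT_comp => //; apply: measurable_funB => //.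
      by apply: measurable_funM => //; exact: measurable_funM.
    under eq_integral => w _ do rewrite gee0_abs ?lee_fin ?expR_ge0//.
    by rewrite gaussian_integral_tilt ltry.
  move=> w _; rewrite lee_fin; apply: le_trans (expR_ge1Dx _).
  by rewrite le_eqVlt; apply/orP; left; apply/eqP; ring.
rewrite (integral_affine _ _ _ _ _ iX mE) lee_fin.
rewrite (_ : _ + _ = 1 + m ^+ 2 / (s ^+ 2 *+ 2)); last by field; rewrite gt_eqF.
rewrite gerDl pmulr_lle0 ?invr_gt0 ?pmulrn_lgt0// => m2.
by apply/eqP; rewrite -sqrf_eq0 eq_le m2 sqr_ge0.
Qed.

Lemma gaussian_second_moment : (\int[P]_w (X w ^+ 2)%:E = (s ^+ 2)%:E)%E.
Proof.
have iX := gaussian_integrable_sqr.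
have /fineK/esym mE := integrable_fin_num measurableT iX.
have : (0 <= \int[P]_w (X w ^+ 2)%:E)%E.
  by apply: integral_ge0 => w _; rewrite lee_fin sqr_ge0.
move: mE; set m := fine _ => mE; rewrite mE lee_fin => m0; congr (_%:E).
have key (t : R) : 0 < t -> 0 <= (t - s) * (2 * s * t ^+ 2 - m * (t + s)).
  move=> t0.
  (* The coefficient of [X w ^+ 2] in the exponent that tilts N(0, s^2) to a multiple of N(0, t^2);
     it is negative when [t < s]. *)
  pose c := (t ^+ 2 - s ^+ 2) / ((s * t) ^+ 2 *+ 2).
  have : (\int[P]_w (1 + c * X w ^+ 2)%:E <= (t / s)%:E)%E.
    rewrite -gaussian_integral_dilate//; apply: le_integral => //.
    - exact: integrable_affine.
    - apply/integrableP; split.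
        apply: (measurable_comp_law (fun x =>
          expR (x ^+ 2 * (t ^+ 2 - s ^+ 2) / ((s * t) ^+ 2 *+ 2)))).
        by apply: measurableT_comp => //; do 2 apply: measurable_funM => //.
      under eq_integral => w _ do rewrite gee0_abs ?lee_fin ?expR_ge0//.
      by rewrite gaussian_integral_dilate// ltry.
    move=> w _; rewrite lee_fin; apply: le_trans (expR_ge1Dx _).
    by rewrite lerD2l -[leRHS]mulrA mulrC.
  rewrite (integral_affine _ _ _ _ _ iX mE) lee_fin -subr_ge0.
  rewrite (_ : _ - _ = (t - s) * (2 * s * t ^+ 2 - m * (t + s)) / (2 * (s * t) ^+ 2)).
    by rewrite pmulr_lge0// invr_gt0 mulr_gt0// exprn_gt0// mulr_gt0.
  by rewrite /c; field; rewrite !gt_eqF.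
exact: (second_moment_squeeze _ _ s_gt0 m0 key).
Qed.

End gaussian_moments.

(** * Uncorrelated sums *)

Section independent_product.
Context {d} {T : measurableType d} {R : realType} (P : probability T R).

(** The joint law agrees with the product of the marginals on rectangles, hence everywhere. Fubini
    then leaves [x] times the mean of [Y] as inner integral, which is 0. *)
Lemma integral_mul_indep (X Y : T -> R) :
  measurable_fun setT X -> measurable_fun setT Y ->
  (forall A B, measurable A -> measurable B ->
     (P (X @^-1` A `&` Y @^-1` B) = P (X @^-1` A) * P (Y @^-1` B))%E) ->
  P.-integrable setT (fun w => (X w * Y w)%:E) ->
  P.-integrable setT (EFin \o Y) -> (\int[P]_w (Y w)%:E = 0)%E ->
  (\int[P]_w (X w * Y w)%:E = 0)%E.
Proof.
move=> mX mY XY iXY iY Y0.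
have mX' : measurable_fun setT (X : T -> measurableTypeR R) := mX.
have mY' : measurable_fun setT (Y : T -> measurableTypeR R) := mY.
pose X' : {mfun T >-> measurableTypeR R} :=
  HB.pack (X : T -> measurableTypeR R) (isMeasurableFun.Build _ _ _ _ _ mX').
pose Y' : {mfun T >-> measurableTypeR R} :=
  HB.pack (Y : T -> measurableTypeR R) (isMeasurableFun.Build _ _ _ _ _ mY').
pose Z w : measurableTypeR R * measurableTypeR R := (X w, Y w).
have mZ : measurable_fun setT Z by apply/measurable_fun_pairP.
pose Z' : {mfun T >-> (measurableTypeR R * measurableTypeR R)%type} :=
  HB.pack Z (isMeasurableFun.Build _ _ _ _ _ mZ).
pose h (z : measurableTypeR R * measurableTypeR R) : \bar R := (z.1 * z.2)%:E.
have mh : measurable_fun setT h.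
  apply/measurable_EFinP/measurable_funM; first exact: measurable_fst.
  exact: measurable_snd.
have E S : measurable S -> S `<=` setT ->
    (distribution P X' \x distribution P Y')%E S = distribution P Z' S.
  move=> mS _; apply: product_measure_unique mS => A B mA mB.
  exact: XY.
have iZ : (distribution P Z').-integrable setT h.
  exact: integrable_pushforward.
have -> : (\int[P]_w (X w * Y w)%:E = \int[distribution P Z']_z h z)%E.
  by rewrite integral_distribution.
rewrite -(eq_measure_integral _ E).
rewrite -integral12_prod_meas1; last first.
  apply/integrableP; split => //.
  by rewrite (eq_measure_integral _ E); have /integrableP[] := iZ.
apply: integral0_eq => x _.
rewrite /fubini_F/=.
under eq_integral do rewrite /h/= EFinM.
have iY' : (distribution P Y').-integrable setT (fun y => y%:E).
  by apply: integrable_pushforward => //; exact/measurable_EFinP.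
rewrite integralZl//.
have -> : (\int[distribution P Y']_y y%:E = \int[P]_w (Y w)%:E)%E.
  by rewrite integral_distribution//; exact/measurable_EFinP.
by rewrite Y0 mule0.
Qed.

Lemma integrable_mul_of_sqr (X Y : T -> R) :
  measurable_fun setT X -> measurable_fun setT Y ->
  P.-integrable setT (fun w => (X w ^+ 2)%:E) ->
  P.-integrable setT (fun w => (Y w ^+ 2)%:E) ->
  P.-integrable setT (fun w => (X w * Y w)%:E).
Proof.
move=> mX mY iX iY.
apply: (@le_integrable _ _ _ _ _ _ _ (fun w => (X w ^+ 2)%:E + (Y w ^+ 2)%:E)%E) => //.
- by apply/measurable_EFinP/measurable_funM.
- move=> w _; rewrite -EFinD !abse_EFin lee_fin [leRHS]ger0_norm ?addr_ge0 ?sqr_ge0//.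
  rewrite normrM; have := sqr_ge0 (`|X w| - `|Y w|).
  have := real_normK (num_real (X w)); have := real_normK (num_real (Y w)).
  have := normr_ge0 (X w); have := normr_ge0 (Y w); nra.
exact: integrableD.
Qed.

(** Markov's inequality for the square of the sum; after expansion only the diagonal products have a
    nonzero integral. *)
Lemma chebyshev_uncorrelated (I : finType) (Q : pred I) (Y : I -> T -> R)
    (v : I -> R) (e : R) : 0 < e ->
  (forall i, measurable_fun setT (Y i)) ->
  (forall i, P.-integrable setT (fun w => (Y i w ^+ 2)%:E)) ->
  (forall i, Q i -> (\int[P]_w (Y i w ^+ 2)%:E <= (v i)%:E)%E) ->
  (forall i j, Q i -> Q j -> i != j -> (\int[P]_w (Y i w * Y j w)%:E = 0)%E) ->
  (P [set w | (e <= `|\sum_(i | Q i) Y i w|)%R]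
     <= ((\sum_(i | Q i) v i) / e ^+ 2)%:E)%E.
Proof.
move=> e0 mY iY vY Y0.
have iYY i j := integrable_mul_of_sqr _ _ (mY i) (mY j) (iY i) (iY j).
have mS : measurable_fun setT (fun w => \sum_(i | Q i) Y i w).
  under eq_fun do rewrite big_mkcond.
  by apply: measurable_sum => i; case: (Q i).
have e2 : 0 < e ^+ 2 by rewrite exprn_gt0.
rewrite EFinM lee_pdivlMr// muleC.
have := @le_integral_abse _ _ _ P setT measurableT
  (fun w => ((\sum_(i | Q i) Y i w) ^+ 2)%:E) _ _ e2.
rewrite setTI.
have -> : [set w | ((e ^+ 2)%:E <= `|((\sum_(i | Q i) Y i w) ^+ 2)%:E|)%E] =
          [set w | e <= `|\sum_(i | Q i) Y i w|].
  apply/seteqP; split => w /=; rewrite lee_fin normrX ler_sqr ?nnegrE// ltW//.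
move=> /(_ _)/le_trans; apply.
  by apply/measurable_EFinP/measurable_funX.
under eq_integral => w _.
  rewrite gee0_abs ?lee_fin ?sqr_ge0// expr2 mulr_suml -sumEFin.
  under eq_bigr do rewrite mulr_sumr -sumEFin.
  over.
rewrite integral_sum//; last by move=> i; apply: integrable_sum.
rewrite -sumEFin; apply: lee_sum => i Qi.
rewrite integral_sum// (bigD1 i)//= big1 ?adde0; last first.
  by move=> j /andP[Qj ji]; rewrite Y0// eq_sym.
by under eq_integral do rewrite -expr2; exact: vY.
Qed.

End independent_product.

(** * The Frobenius norm of a shifted GOE matrix *)

Section GOE_concentration.
Context {d} {T : measurableType d} {R : realType} (P : probability T R).
Variables (N : nat) (G : T -> 'M[R]_N).
Hypotheses (N_gt0 : (0 < N)%N) (GOE_G : GOE_matrix P G).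

(** Mutual independence is applied to a family of sets equal to [setT] away from the two positions,
    so that all other factors are 1. *)
Lemma GOE_pair_indep (p p' : 'I_N * 'I_N) (A B : set R) :
  (p.1 <= p.2)%N -> (p'.1 <= p'.2)%N -> p != p' ->
  measurable A -> measurable B ->
  (P ((fun w => G w p.1 p.2) @^-1` A `&` (fun w => G w p'.1 p'.2) @^-1` B) =
   P ((fun w => G w p.1 p.2) @^-1` A) * P ((fun w => G w p'.1 p'.2) @^-1` B))%E.
Proof.
move=> hp hp' pp' mA mB; have [_ [_ [_ indep]]] := GOE_G.
pose C (i j : 'I_N) : set R :=
  if (i, j) == p then A else if (i, j) == p' then B else setT.
have Cp : C p.1 p.2 = A by rewrite /C -surjective_pairing eqxx.
have Cp' : C p'.1 p'.2 = B.
  by rewrite /C -surjective_pairing eq_sym (negbTE pp') eqxx.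
have mC i j : measurable (C i j) by rewrite /C; case: ifP => // _; case: ifP.
have /esym := indep C mC.
rewrite (bigD1 p)//= (bigD1 p')//=; last by rewrite hp' eq_sym.
rewrite Cp Cp' big1 ?mule1 => [->|q /andP[/andP[_ qp] qp']]; last first.
  rewrite /C -surjective_pairing (negbTE qp) (negbTE qp') preimage_setT.
  exact: probability_setT.
congr (P _); apply/seteqP; split => [w /= [Aw Bw] q /= hq|w Cw].
- by rewrite /C -surjective_pairing; case: eqP => [->//|_]; case: eqP => [->|].
- by split => /=; [have := Cw p hp; rewrite /= Cp|have := Cw p' hp'; rewrite /= Cp'].
Qed.

Let sd (i j : 'I_N) : R := Num.sqrt ((if i == j then 2 else 1) / N%:R).

Let N_gt0' : 0 < N%:R :> R. Proof. by rewrite ltr0n. Qed.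

Let sd_sqr i j : sd i j ^+ 2 = (if i == j then 2 else 1) / N%:R.
Proof. by rewrite sqr_sqrtr// divr_ge0//; case: ifP. Qed.

Let sd_gt0 i j : 0 < sd i j.
Proof. by rewrite sqrtr_gt0 divr_gt0//; case: ifP. Qed.

Let wt (p : 'I_N * 'I_N) : R := if p.1 == p.2 then 1 else 2.

(** [wt] counts the occurrences of an entry in the full matrix; diagonal entries occur once instead
    of twice, and their doubled variance compensates exactly. *)
Let wt_sd p : wt p * sd p.1 p.2 ^+ 2 = 2 / N%:R.
Proof. by rewrite sd_sqr /wt; case: eqP => _; rewrite ?mul1r// mulrA mulr1. Qed.

(** Each of the [N] rows contributes [2 / N + (N - 1) / N]. The total is the mean squared Frobenius
    norm of [G] and matches the denominator [N + 1] of [sigma2_hat]. *)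
Let sum_sd : \sum_i \sum_j sd i j ^+ 2 = N%:R + 1.
Proof.
under eq_bigr => i _.
  under eq_bigr do rewrite sd_sqr.
  rewrite (bigD1 i)//= eqxx.
  under eq_bigr => j ji do rewrite eq_sym (negbTE ji).
  rewrite sumr_const cardC1 card_ord -[X in _ + X]mulr_natl.
  rewrite (_ : 2 / N%:R + N.-1%:R * (1 / N%:R) = (N%:R + 1) / N%:R); last first.
    by rewrite -subn1 natrB//; field; rewrite gt_eqF.
  over.
by rewrite sumr_const card_ord -[LHS]mulr_natl mulrCA divff ?mulr1// gt_eqF.
Qed.

(* [464 = 2 * (57 + 1) * 2^2]: 57 is the fourth moment constant and [2 / N] the
   common value of multiplicity times variance over all entries. *)
Lemma GOE_frobenius_concentration (A : 'M[R]_N) (sigma e : R) :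
  A^T = A -> 0 < e ->
  (P [set w | (e <= `|\sum_i \sum_j (A + sigma *: G w) i j ^+ 2 -
     (\sum_i \sum_j A i j ^+ 2 + sigma ^+ 2 * (N%:R + 1))|)%R] <=
   ((16 * sigma ^+ 2 * (\sum_i \sum_j A i j ^+ 2) + 464 * sigma ^+ 4)
      / e ^+ 2)%:E)%E.
Proof.
move=> AT e0; have [GT [mG [Glaw _]]] := GOE_G.
have AC i j : A i j = A j i by rewrite -[in LHS]AT mxE.
have GC w i j : G w i j = G w j i by rewrite -[in LHS](GT w) mxE.
have sdC i j : sd i j = sd j i by rewrite /sd eq_sym.
(* [Y p] is the centred contribution of the pair [p] to the squared Frobenius norm of
   [A + sigma *: G]: the expanded square minus [A p.1 p.2 ^+ 2] and minus the mean of the quadratic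
   noise term. *)
pose phi p (x : R) : R := wt p * (2 * sigma * A p.1 p.2 * x +
  sigma ^+ 2 * (x ^+ 2 - sd p.1 p.2 ^+ 2)).
pose Y p w : R := phi p (G w p.1 p.2).
pose v p : R := 16 * sigma ^+ 2 / N%:R * (wt p * A p.1 p.2 ^+ 2) +
  464 * sigma ^+ 4 / N%:R ^+ 2.
have mphi p : measurable_fun setT (phi p).
  apply: measurable_funM => //; apply: measurable_funD.
    exact: measurable_funM.
  by apply: measurable_funM => //; exact: measurable_funB.
have mY p : measurable_fun setT (Y p) by exact: measurableT_comp.
have i1 p := gaussian_integrable P _ _
  (sd_gt0 p.1 p.2) (mG p.1 p.2) (Glaw p.1 p.2).
have i2 p := gaussian_integrable_sqr P _ _
  (sd_gt0 p.1 p.2) (mG p.1 p.2) (Glaw p.1 p.2).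
have i4 p := gaussian_integrable_fourth P _ _
  (sd_gt0 p.1 p.2) (mG p.1 p.2) (Glaw p.1 p.2).
have m1 p := gaussian_mean P _ _
  (sd_gt0 p.1 p.2) (mG p.1 p.2) (Glaw p.1 p.2).
have m2 p := gaussian_second_moment P _ _
  (sd_gt0 p.1 p.2) (mG p.1 p.2) (Glaw p.1 p.2).
have m4 p := gaussian_fourth_moment P _ _
  (sd_gt0 p.1 p.2) (mG p.1 p.2) (Glaw p.1 p.2).
(* [D p] dominates the square of [Y p], by [(x + y)^2 <= 2 x^2 + 2 y^2] followed by
   [(x^2 - s^2)^2 <= x^4 + s^4]. *)
pose a p : R := 8 * sigma ^+ 2 * A p.1 p.2 ^+ 2 * wt p ^+ 2.
pose b p : R := 2 * sigma ^+ 4 * wt p ^+ 2.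
pose D p w : \bar R := ((a p)%:E * (G w p.1 p.2 ^+ 2)%:E +
   ((b p * sd p.1 p.2 ^+ 4)%:E + (b p)%:E * (G w p.1 p.2 ^+ 4)%:E))%E.
have b0 p : 0 <= b p by rewrite /b mulr_ge0 ?sqr_ge0// mulr_ge0// exprn_even_ge0.
have iD1 p : P.-integrable setT (fun w => ((a p)%:E * (G w p.1 p.2 ^+ 2)%:E)%E).
  exact: integrableZl.
have iD2 p : P.-integrable setT (fun w : T => ((b p)%:E * (G w p.1 p.2 ^+ 4)%:E)%E).
  exact: integrableZl.
have iD3 p : P.-integrable setT (fun w : T => ((b p * sd p.1 p.2 ^+ 4)%:E +
     (b p)%:E * (G w p.1 p.2 ^+ 4)%:E)%E).
  by apply: integrableD => //; exact: finite_measure_integrable_cst.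
have iD p : P.-integrable setT (D p) by exact: integrableD.
have YD p w : ((Y p w ^+ 2)%:E <= D p w)%E.
  rewrite /D -!EFinM -!EFinD lee_fin /Y /phi /a /b.
  set x := G w _ _; set s := sd _ _; set W := wt p.
  have h1 : (x ^+ 2 - s ^+ 2) ^+ 2 <= s ^+ 4 + x ^+ 4.
    rewrite -subr_ge0 (_ : _ - _ = 2 * (x ^+ 2 * s ^+ 2)); last by ring.
    by rewrite mulr_ge0// mulr_ge0// sqr_ge0.
  have h2 : 0 <= (2 * sigma * A p.1 p.2 * x -
      sigma ^+ 2 * (x ^+ 2 - s ^+ 2)) ^+ 2 by exact: sqr_ge0.
  have h3 : 0 <= sigma ^+ 4 * (s ^+ 4 + x ^+ 4 - (x ^+ 2 - s ^+ 2) ^+ 2).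
    by rewrite mulr_ge0 ?subr_ge0// exprn_even_ge0.
  rewrite exprMn.
  rewrite [leRHS](_ : _ = W ^+ 2 * (8 * sigma ^+ 2 * A p.1 p.2 ^+ 2 * x ^+ 2 +
    2 * sigma ^+ 4 * (s ^+ 4 + x ^+ 4))); last by ring.
  apply: ler_wpM2l; first exact: sqr_ge0.
  by clear -h2 h3; nra.
have iY p : P.-integrable setT (fun w => (Y p w ^+ 2)%:E).
  apply: le_integrable (iD p) => //.
    by apply/measurable_EFinP/measurable_funX.
  move=> w _; rewrite gee0_abs; last by rewrite lee_fin sqr_ge0.
  by apply: le_trans (YD p w) _; exact: lee_abs.
have vY p : (\int[P]_w (Y p w ^+ 2)%:E <= (v p)%:E)%E.
  apply: (@le_trans _ _ (\int[P]_w D p w)%E).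
    by apply: le_integral => // w _; exact: YD.
  rewrite /D integralD// integralZl// m2 integralD//; last first.
    exact: finite_measure_integrable_cst.
  rewrite integralZl// integral_cst//.
  apply: (@le_trans _ _ ((a p * sd p.1 p.2 ^+ 2)%:E +
    ((b p * sd p.1 p.2 ^+ 4)%:E + (b p * (57 * sd p.1 p.2 ^+ 4))%:E))%E).
    rewrite -EFinM leeD2l// leeD//.
      rewrite -[leRHS]mule1; apply: lee_wpmul2l.
        by rewrite lee_fin mulr_ge0// exprn_ge0// ltW.
      exact: probability_le1.
    by rewrite [leRHS]EFinM; apply: lee_wpmul2l => //; rewrite lee_fin.
  rewrite -!EFinD lee_fin /a /b /v.
  have -> : sd p.1 p.2 ^+ 4 = (sd p.1 p.2 ^+ 2) ^+ 2 by rewrite -exprM.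
  rewrite [leLHS](_ : _ = 8 * sigma ^+ 2 * A p.1 p.2 ^+ 2 * wt p *
      (wt p * sd p.1 p.2 ^+ 2) +
    116 * sigma ^+ 4 * (wt p * sd p.1 p.2 ^+ 2) ^+ 2); last by ring.
  rewrite wt_sd le_eqVlt; apply/orP; left; apply/eqP; field.
  by rewrite gt_eqF.
have Ymean p : (\int[P]_w (Y p w)%:E = 0)%E.
  pose c := wt p * sigma ^+ 2.
  under eq_integral => w _.
    rewrite (_ : Y p w = wt p * (2 * sigma * A p.1 p.2) * G w p.1 p.2 +
      (- (c * sd p.1 p.2 ^+ 2) + c * G w p.1 p.2 ^+ 2)); last first.
      by rewrite /Y /phi /c; ring.
    rewrite EFinD EFinM.
    over.
  rewrite integralD//; last 2 first.
  - exact: integrableZl.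
  - exact: (integrable_affine P _ _ (fun w => G w p.1 p.2 ^+ 2) (i2 p)).

  rewrite integralZl// m1 mule0 add0e (integral_affine _ _ _ _ _ (i2 p) (m2 p)).
  by rewrite addNr.
have Yint p : P.-integrable setT (EFin \o Y p) by exact: integrable_of_sqr.
have Yunc (p p' : 'I_N * 'I_N) : (p.1 <= p.2)%N -> (p'.1 <= p'.2)%N -> p != p' ->
    (\int[P]_w (Y p w * Y p' w)%:E = 0)%E.
  move=> hp hp' pp'; apply: integral_mul_indep => //.
  - move=> B C mB mC.
    apply: (GOE_pair_indep p p' (phi p @^-1` B) (phi p' @^-1` C)) => //.
      by rewrite -[X in measurable X]setTI; exact: mphi.
    by rewrite -[X in measurable X]setTI; exact: mphi.
  - exact: integrable_mul_of_sqr.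
have -> : [set w | e <= `|\sum_i \sum_j (A + sigma *: G w) i j ^+ 2 -
     (\sum_i \sum_j A i j ^+ 2 + sigma ^+ 2 * (N%:R + 1))|] =
   [set w | e <= `|\sum_(p : 'I_N * 'I_N | (p.1 <= p.2)%N) Y p w|].
  apply/seteqP; suff H w : \sum_i \sum_j (A + sigma *: G w) i j ^+ 2 -
     (\sum_i \sum_j A i j ^+ 2 + sigma ^+ 2 * (N%:R + 1)) =
     \sum_(p : 'I_N * 'I_N | (p.1 <= p.2)%N) Y p w by split=> w /=; rewrite H.
  rewrite -sum_sd.
  rewrite (@sum_sym_matrix _ _ (fun i j => (A + sigma *: G w) i j ^+ 2));
    last first.
    by move=> i j; rewrite !mxE AC GC.
  rewrite (@sum_sym_matrix _ _ (fun i j => A i j ^+ 2));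
    last by move=> i j; rewrite AC.
  rewrite (@sum_sym_matrix _ _ (fun i j => sd i j ^+ 2));
    last by move=> i j; rewrite sdC.
  rewrite mulr_sumr -big_split -sumrB/=; apply: eq_bigr => p _.
  by rewrite !mxE /Y /phi -/(wt p); ring.
apply: le_trans (chebyshev_uncorrelated P _ _ Y v e e0 mY iY (fun p _ => vY p) Yunc) _.
rewrite lee_fin ler_pM2r ?invr_gt0 ?exprn_gt0// /v big_split/=.
rewrite -mulr_sumr -(@sum_sym_matrix _ _ (fun i j => A i j ^+ 2));
  last by move=> i j; rewrite AC.
(* The dependence on [N] disappears: the linear part carries a factor [1 / N <= 1], and the
   quadratic part is a sum of at most [N ^ 2] terms of size [c], with [c] proportional to
   [1 / N ^ 2]. *)
apply: lerD.
  apply: ler_wpM2r.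
    by apply: sumr_ge0 => i _; apply: sumr_ge0 => j _; exact: sqr_ge0.
  by rewrite ler_pdivrMr// ler_peMr ?ler1n// mulr_ge0// sqr_ge0.
have c0 : 0 <= 464 * sigma ^+ 4 / N%:R ^+ 2.
  apply: mulr_ge0; last by rewrite invr_ge0 sqr_ge0.
  by apply: mulr_ge0; [exact: ler0n|rewrite exprn_even_ge0].
rewrite -[leRHS](@divfK _ (N%:R ^+ 2)); last by rewrite expf_neq0// gt_eqF.
move: (464 * sigma ^+ 4 / N%:R ^+ 2) c0 => c c0.
apply: (@le_trans _ _ (\sum_(p : 'I_N * 'I_N) c)).
  rewrite [leRHS](bigID (fun p : 'I_N * 'I_N => (p.1 <= p.2)%N))/=.
  by rewrite lerDl; exact: sumr_ge0.
by rewrite sumr_const card_prod card_ord -[leLHS]mulr_natr natrM -expr2.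
Qed.

End GOE_concentration.

(** * Events of probability tending to one *)

(* [P (A n)] is meaningless when [A n] is not measurable, hence the detour through
   measurable sets [C n] covering the complements. *)
Definition whp {d} {T : measurableType d} {R : realType} (P : probability T R)
    (A : nat -> T -> Prop) : Prop :=
  exists C : nat -> set T,
    [/\ forall n, measurable (C n), P (C n) @[n --> \oo] --> 0%E &
        \forall n \near \oo, forall w, ~ C n w -> A n w].

Section measurable_comparison.
Context {d} {T : measurableType d} {R : realType} (f g : T -> R).
Hypotheses (mf : measurable_fun setT f) (mg : measurable_fun setT g).

Lemma measurable_le_set : measurable [set w | f w <= g w].
Proof. by rewrite -[X in measurable X]setTI; exact: measurable_fun_le. Qed.

Lemma measurable_gt_set : measurable [set w | g w < f w].
Proof.
rewrite (_ : mkset _ = ~` [set w | f w <= g w]).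
  exact/measurableC/measurable_le_set.
by apply/seteqP; split => w /=; rewrite ltNge => /negP.
Qed.

End measurable_comparison.

Section whp_theory.
Context {d} {T : measurableType d} {R : realType} (P : probability T R).
Implicit Types A B : nat -> T -> Prop.

Lemma whp_near A : (\forall n \near \oo, forall w, A n w) -> whp P A.
Proof.
move=> hA; exists (fun=> set0); split => //.
  by under eq_fun do rewrite measure0; exact: cvg_cst.
by apply: filterS hA => n An w _; exact: An.
Qed.

Lemma whpS A B : (\forall n \near \oo, forall w, A n w -> B n w) ->
  whp P A -> whp P B.
Proof.
move=> AB [C [mC C0 CA]]; exists C; split => //.
by apply: filterS2 AB CA => n AB CA w /CA /AB.
Qed.

Lemma whpI A B : whp P A -> whp P B -> whp P (fun n w => A n w /\ B n w).
Proof.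
move=> [C [mC C0 CA]] [D [mD D0 DB]].
exists (fun n => C n `|` D n); split.
- by move=> n; exact: measurableU.
- apply: (@squeeze_cvge _ _ _ _ (cst 0%E) _ (fun n => (P (C n) + P (D n))%E)).
  + by apply: nearW => n; rewrite measure_ge0/= measureU2.
  + exact: cvg_cst.
  + by rewrite -[X in _ --> X]adde0; apply: cvgeD.
- apply: filterS2 CA DB => n CA DB w CD.
  by split; [apply: CA|apply: DB] => ?; apply: CD; [left|right].
Qed.

Lemma whp_all (m : nat) (A : nat -> nat -> T -> Prop) :
  (forall i, (i < m)%N -> whp P (A i)) ->
  whp P (fun n w => forall i, (i < m)%N -> A i n w).
Proof.
elim: m => [_|m IH hA]; first exact/whp_near/nearW.
have /whpI/(_ (hA m (ltnSn m))) := IH (fun i im => hA i (ltnW im)).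
apply: whpS; apply: nearW => n w [hi hm] i; rewrite ltnS leq_eqVlt.
by case/orP => [/eqP->//|]; exact: hi.
Qed.

(** The way back from [whp] to genuine probabilities, once the events are known to be measurable. *)
Lemma cvg_whp (A : nat -> set T) :
  (forall n, measurable (A n)) -> whp P A -> P (A n) @[n --> \oo] --> 1%E.
Proof.
move=> mA [C [mC C0 CA]].
apply: (@squeeze_cvge _ _ _ _ (fun n => (1 - P (C n))%E) _ (cst 1%E)).
- near=> n; rewrite probability_le1// andbT.
  have CAn : forall w, ~ C n w -> A n w by near: n.
  rewrite -probability_setC//; apply: le_measure; rewrite ?inE//.
    exact: measurableC.
- rewrite -[X in _ --> X]sube0; apply: cvgeB => //; first exact: cvg_cst.
- exact: cvg_cst.
Unshelve. all: by end_near. Qed.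

(** The covering sets are the tail unions of the deviation events. They decrease to a subset of the
    null set of non-convergence, so continuity from above applies. *)
Lemma whp_ae_cvg (f : nat -> T -> R) (a : R) :
  (forall n, measurable_fun setT (f n)) ->
  {ae P, forall w, f n w @[n --> \oo] --> a} ->
  forall e, 0 < e -> whp P (fun n w => `|f n w - a| < e).
Proof.
move=> mf [N [mN N0 fN]] e e0.
pose D m := [set w | e <= `|f m w - a|].
have mD m : measurable (D m).
  apply: measurable_le_set => //.
  by apply: measurableT_comp => //; exact: measurable_funB.
exists (fun n => \bigcup_(m >= n) D m); split.
- by move=> n; exact: bigcup_measurable.
- have -> : 0%E = P (\bigcap_n \bigcup_(m >= n) D m).
    apply/esym/eqP; rewrite eq_le measure_ge0 andbT -N0.
    apply: le_measure; rewrite ?inE//.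
      by apply: bigcap_measurable => // n _; exact: bigcup_measurable.
    apply: subset_trans fN => w /= Dw /cvgrPdist_lt/(_ e e0)[n _ fe].
    have [m nm] := Dw n I.
    by apply/negP; rewrite -ltNge distrC; exact: fe.
  apply: nonincreasing_cvg_mu => //.
  + by rewrite (le_lt_trans (probability_le1 _ _)) ?ltry//; exact: bigcup_measurable.
  + by move=> n; exact: bigcup_measurable.
  + by apply: bigcap_measurable => // n _; exact: bigcup_measurable.
  + move=> m n mn; apply/subsetPset => w [i /= ni Dw]; exists i => //=.
    exact: leq_trans ni.
- apply: nearW => n w nD; rewrite ltNge; apply/negP => fe.
  by apply: nD; exists n => /=.
Qed.

Lemma cvge0_prob (C : nat -> set T) : (forall n, measurable (C n)) ->
  (forall e, 0 < e -> \forall n \near \oo, (P (C n) <= e%:E)%E) ->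
  P (C n) @[n --> \oo] --> 0%E.
Proof.
move=> mC C0; apply/fine_cvgP; split.
  by apply: nearW => n; rewrite fin_num_measure.
apply/cvgrPdist_le => e e0; apply: filterS (C0 e e0) => n Ce /=.
by rewrite sub0r normrN ger0_norm ?fine_ge0// -lee_fin fineK// fin_num_measure.
Qed.

(** For a fixed [x] with [F x] close to 1, eventually [x <= b n], so exceeding [b n] is at most as
    likely as exceeding [x]. *)
Lemma whp_tight (f : nat -> T -> R) (F : R -> R) (b : nat -> R) :
  (forall n, measurable_fun setT (f n)) ->
  (forall x, P [set w | f n w <= x] @[n --> \oo] --> (F x)%:E) ->
  F x @[x --> +oo] --> (1 : R) -> b @ \oo --> +oo ->
  whp P (fun n w => f n w <= b n).
Proof.
move=> mf fF F1 bo.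
exists (fun n => [set w | b n < f n w]); split.
- by move=> n; exact: measurable_gt_set.
- have mle n x : measurable [set w | f n w <= x] by exact: measurable_le_set.
  have mlt n : measurable [set w | b n < f n w] by exact: measurable_gt_set.
  apply: cvge0_prob => // e e0.
  have /cvgrPdist_lt/(_ (e / 2)) := F1.
  rewrite divr_gt0// => /(_ isT) [x0 [x0r hx0]].
  (* A neighbourhood of [+oo] only controls points strictly above [x0]. *)
  pose x := x0 + 1.
  have /fine_cvgP[_ /cvgrPdist_lt/(_ (e / 2))] := fF x.
  rewrite divr_gt0// => /(_ isT) h1.
  have /cvgryPge/(_ x) h2 := bo.
  apply: filterS2 h1 h2 => n h1 h2.
  have Fx := hx0 x ltac:(by rewrite /x ltrDl).
  have PC : (P [set w | (b n < f n w)%R] <= 1 - P [set w | (f n w <= x)%R])%E.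
    rewrite -probability_setC//; apply: le_measure; rewrite ?inE//.
      exact: measurableC.
    by move=> w /= bf; apply/negP; rewrite -ltNge; exact: le_lt_trans bf.
  apply: le_trans PC _.
  rewrite -[P [set w | _ <= x]]fineK ?fin_num_measure// -EFinB lee_fin.
  move: Fx h1 => /=; rewrite !ltr_norml => /andP[_ ?] /andP[_ ?]; lra.
- by apply: nearW => n w /negP; rewrite -leNgt.
Qed.

End whp_theory.

(** * The scores and their minimiser *)

(** Strictness of the minimum makes the choice among ties irrelevant. *)
Lemma khat_eq {R : realType} (q k : nat) (F : nat -> R) : (k <= q)%N ->
  (forall j, (j <= q)%N -> j <> k -> F k < F j) -> khat q F = k.
Proof.
move=> kq kF; rewrite /khat; case: Order.TotalTheory.arg_minP => // i _ iF.
apply: contrapT => ik.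
have /(_ isT) := iF (Ordinal (kq : (k < q.+1)%N)).
by rewrite leNgt kF// -ltnS.
Qed.

(** The minimiser is a function of the finite table of comparisons between scores, so the event is a
    finite union of finite intersections of comparison events. *)
Lemma measurable_khat {d} {T : measurableType d} {R : realType} (q k : nat)
    (F : T -> nat -> R) :
  (forall j, measurable_fun setT (fun w => F w j)) ->
  measurable [set w | khat q (F w) = k].
Proof.
move=> mF.
pose tab w := [ffun p : 'I_q.+1 * 'I_q.+1 => F w p.1 <= F w p.2].
pose h (b : {ffun 'I_q.+1 * 'I_q.+1 -> bool}) : nat :=
  odflt ord0 [pick i | [forall j, b (i, j)]].
have hE w : khat q (F w) = h (tab w).
  rewrite /khat /Order.arg_min /extremum /h; congr (nat_of_ord (odflt _ _)).
  apply: eq_pick => i /=; apply/eq_forallb => j.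
  by rewrite ffunE.
have -> : [set w | khat q (F w) = k] = \bigcup_(b in [set b | h b = k])
    \bigcap_(p in [set: 'I_q.+1 * 'I_q.+1]) [set w | (F w p.1 <= F w p.2) = b p].
  apply/seteqP; split=> w /=.
    by rewrite hE => hk; exists (tab w) => //= p _ /=; rewrite ffunE.
  move=> [b <- hb]; rewrite hE; congr h; apply/ffunP => p.
  by rewrite ffunE; exact: hb.
apply: fin_bigcup_measurable => [|b _]; first exact: finite_finset.
apply: fin_bigcap_measurable => [|p _]; first exact: finite_finset.
case: (b p); first exact: measurable_le_set.
rewrite (_ : mkset _ = [set w | F w p.2 < F w p.1]); first exact: measurable_gt_set.
by apply/seteqP; split => w /=; rewrite ltNge; [move=> ->|move/negbTE].
Qed.

(** * Measurability of the scores *)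

Section score_measurability.
Context {d} {T : measurableType d} {R : realType} (l : T -> nat -> R).
Hypothesis ml : forall i, measurable_fun setT (fun w => l w i).

Lemma measurable_tail_sq (N j : nat) :
  measurable_fun setT (fun w => tail_sq N j (l w)).
Proof. by apply: measurable_sum => i; exact: measurable_funX. Qed.

Lemma measurable_GAIC_known (N : nat) (C sigma gamma : R) (j : nat) :
  measurable_fun setT (fun w => GAIC_known N C sigma gamma (l w) j).
Proof.
apply: measurable_funD => //; apply: measurable_funD => //.
by apply: measurable_funM => //; exact: measurable_tail_sq.
Qed.

Lemma tail_sq_ge0 (N j : nat) (x : nat -> R) : 0 <= tail_sq N j x.
Proof. by apply: sumr_ge0 => i _; exact: sqr_ge0. Qed.

Lemma measurable_GAIC_unknown (N : nat) (C gamma : R) (j : nat) :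
  measurable_fun setT (fun w => GAIC_unknown N C gamma (l w) j).
Proof.
have ms : measurable_fun setT (fun w => sigma2_hat N j (l w)).
  by apply: measurable_funM => //; exact: measurable_tail_sq.
apply: measurable_funD => //; apply: measurable_funD => //; last first.
  apply: measurable_funM; last exact: measurable_tail_sq.
  apply: measurable_funM => //.
  (* Inversion is a real power on nonnegative numbers, including at 0, where both conventions give
     0. *)
  have -> : (fun w => (2 * sigma2_hat N j (l w))^-1) =
            (fun w => (2 * sigma2_hat N j (l w)) `^ (-1)).
    apply/funext => w; rewrite powR_inv1// mulr_ge0// divr_ge0 ?tail_sq_ge0//.
  have m2 : measurable_fun setT (fun w => 2 * sigma2_hat N j (l w)).
    exact: measurable_funM.
  exact: (measurableT_comp (measurable_powR (-1)) m2).
apply: measurable_funD => //; apply: measurable_funM => //.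
exact: (measurableT_comp (@measurable_ln R) ms).
Qed.

End score_measurability.

(** * Deterministic comparison of scores *)

Section score_gap.
Context {R : realType} (N q k : nat) (l : nat -> R).
Hypotheses (kq : (k <= q)%N) (qN : (q < N)%N).

Lemma tail_sqB (i j : nat) : (i <= j)%N -> (j <= N)%N ->
  tail_sq N i l - tail_sq N j l = \sum_(i <= m < j) l m ^+ 2.
Proof. by move=> ij jN; rewrite /tail_sq (big_cat_nat ij)//= addrK. Qed.

Lemma GAIC_known_gap (C sigma gamma : R) (j : nat) :
  N%:R / (2 * sigma ^+ 2) * (tail_sq N j l - tail_sq N k l) +
    gamma * (npar R N j - npar R N k) =
  GAIC_known N C sigma gamma l j - GAIC_known N C sigma gamma l k.
Proof. by rewrite /GAIC_known; ring. Qed.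

(** With the estimated variance, the quadratic term is the same constant [N (N + 1) / 2] at [j] and
    at [k], so only the logarithms and the penalties differ. The logarithms are linearised by
    [ln x <= x - 1] at the ratio of the two tails. *)
Lemma GAIC_unknown_gap (C gamma : R) (j : nat) :
  0 < tail_sq N j l -> 0 < tail_sq N k l ->
  N%:R / (2 * sigma2_hat N j l) * (tail_sq N j l - tail_sq N k l) +
    gamma * (npar R N j - npar R N k) <=
  GAIC_unknown N C gamma l j - GAIC_unknown N C gamma l k.
Proof.
move=> Sj Sk; rewrite /GAIC_unknown.
have N1 : 0 < N%:R + 1 :> R by rewrite ltr_wpDl.
have half m : 0 < tail_sq N m l -> N%:R / (2 * sigma2_hat N m l) * tail_sq N m l =
    N%:R * (N%:R + 1) / 2.
  by move=> Sm; rewrite /sigma2_hat; field; rewrite !gt_eqF.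
rewrite !half//.
have lnB : ln (sigma2_hat N j l) - ln (sigma2_hat N k l) =
           - ln (tail_sq N k l / tail_sq N j l).
  rewrite /sigma2_hat !ln_div ?posrE//; ring.
have : ln (tail_sq N k l / tail_sq N j l) <= tail_sq N k l / tail_sq N j l - 1.
  have := @le_ln1Dx R (tail_sq N k l / tail_sq N j l - 1).
  by rewrite [1 + _]addrC subrK; apply; rewrite ltrBrDr addNr divr_gt0.
move: lnB; set x := ln (tail_sq N k l / _); set y := ln _; set z := ln _.
move=> lnB xle.
rewrite -subr_ge0 [leRHS](_ : _ = N%:R * (N%:R + 1) / 2 * (y - z) -
  N%:R / (2 * sigma2_hat N j l) * (tail_sq N j l - tail_sq N k l)); last by ring.
rewrite lnB (_ : N%:R / _ * _ =
  N%:R * (N%:R + 1) / 2 * (1 - tail_sq N k l / tail_sq N j l)); last first.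
  by rewrite /sigma2_hat; field; rewrite !gt_eqF.
rewrite -mulrBr mulr_ge0 ?divr_ge0 ?mulr_ge0 ?ler0n ?(ltW N1)//.
by move: xle; rewrite -subr_ge0; congr (0 <= _); ring.
Qed.

Lemma npar_ub (j : nat) : (j <= k)%N ->
  npar R N k - npar R N j <= N%:R * (k - j)%:R.
Proof.
move=> jk; rewrite /npar !natrM natrB// -subr_ge0.
rewrite [leRHS](_ : _ = (k%:R * (k%:R - 1) - j%:R * (j%:R - 1)) / 2); last by field.
apply: divr_ge0 => //.
(* The map [x (x - 1)] is monotone on integers but not on [[0, 1]]; the case [j < k] therefore uses
   [j + 1 <= k]. *)
move: jk; rewrite leq_eqVlt => /orP[/eqP->|jk]; first by rewrite subrr.
have : (j%:R + 1 <= k%:R :> R) by rewrite natr1 ler_nat.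
have : 0 <= j%:R :> R by []. by nra.
Qed.

Lemma npar_lb (j : nat) : (k <= j <= q)%N ->
  N%:R * (j - k)%:R - q%:R ^+ 2 <= npar R N j - npar R N k.
Proof.
move=> /andP[kj jq]; rewrite /npar !natrM natrB// -subr_ge0.
rewrite [leRHS](_ : _ =
  q%:R ^+ 2 - (j%:R * (j%:R - 1) - k%:R * (k%:R - 1)) / 2); last by field.
have : (j%:R <= q%:R :> R) by rewrite ler_nat.
have : 0 <= j%:R :> R by [].
have : 0 <= k%:R :> R by [].
have : (k%:R <= j%:R :> R) by rewrite ler_nat.
by nra.
Qed.

(** For [j < k], each omitted spike costs more than the [gamma * N] saved in penalty. For [j > k],
    each extra eigenvalue improves the fit by at most [N * (gamma - eta)], and the surplus [N * eta]
    absorbs the quadratic correction of [npar], bounded by [q ^ 2]. *)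
Lemma score_argmin (gamma eta : R) (s F : nat -> R) :
  0 < gamma -> gamma * q%:R ^+ 2 < N%:R * eta ->
  (forall j, (j <= q)%N -> 0 < s j) ->
  (forall i j, (j <= q)%N -> (j <= i < k)%N -> 2 * gamma * s j < l i ^+ 2) ->
  (forall i j, (j <= q)%N -> (k <= i < j)%N ->
     l i ^+ 2 <= 2 * s j * (gamma - eta)) ->
  (forall j, (j <= q)%N ->
     N%:R / (2 * s j) * (tail_sq N j l - tail_sq N k l) +
     gamma * (npar R N j - npar R N k) <= F j - F k) ->
  forall j, (j <= q)%N -> j <> k -> F k < F j.
Proof.
move=> g0 qeta s0 lbig lsmall gap j jq jk; rewrite -subr_gt0.
apply: lt_le_trans (gap j jq); have sj := s0 j jq.
have N0 : 0 < N%:R :> R by rewrite ltr0n (leq_ltn_trans _ qN).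
have jN : (j <= N)%N := leq_trans jq (ltnW qN).
have kN : (k <= N)%N := leq_trans kq (ltnW qN).
have Ns : 0 < N%:R / (2 * s j) by rewrite divr_gt0// mulr_gt0.
have Nc c : N%:R / (2 * s j) * (2 * s j * c) = N%:R * c.
  by field; rewrite gt_eqF.
have [jltk|kltj|/jk//] := ltngtP j k.
- rewrite tail_sqB ?(ltnW jltk)//.
  have hs : (k - j)%:R * (2 * gamma * s j) < \sum_(j <= i < k) l i ^+ 2.
    rewrite mulr_natl -sumr_const_nat; apply: ltr_sum_nat => // i /andP[ji ik].
    by apply: lbig => //; rewrite ji.
  have := ler_wpM2l (ltW g0) (npar_ub _ (ltnW jltk)).
  move: hs; rewrite -(ltr_pM2l Ns).
  rewrite (_ : N%:R / _ * (_ * (2 * gamma * s j)) =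
      gamma * (N%:R * (k - j)%:R)); last first.
    by field; rewrite gt_eqF.
  by lra.
- rewrite -[tail_sq N j l - _]opprB tail_sqB ?(ltnW kltj)//.
  have hs : \sum_(k <= i < j) l i ^+ 2 <= (j - k)%:R * (2 * s j * (gamma - eta)).
    rewrite mulr_natl -sumr_const_nat big_nat [leRHS]big_nat.
    by apply: ler_sum => i kij; exact: lsmall.
  have kjq : (k <= j <= q)%N by rewrite (ltnW kltj).
  have := ler_wpM2l (ltW g0) (npar_lb _ kjq).
  have := ler_wpM2l (ltW Ns) hs.
  rewrite (_ : N%:R / _ * (_ * (2 * s j * _)) =
      N%:R * (j - k)%:R * (gamma - eta)); last first.
    by field; rewrite gt_eqF.
  have jk1 : 1 <= (j - k)%:R :> R by rewrite ler1n subn_gt0.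
  have eta0 : 0 < eta.
    rewrite -(pmulr_rgt0 _ N0); apply: le_lt_trans qeta.
    by rewrite mulr_ge0 ?sqr_ge0// ltW.
  have : N%:R * eta <= N%:R * (j - k)%:R * eta.
    by rewrite -mulrA ler_pM2l// ler_peMl// ltW.
  by lra.
Qed.

End score_gap.

(** * Consistency *)

Section consistency.
Context {R : realType} {d : measure_display} {T : measurableType d}.
Variables (P : probability T R) (sigma : R) (k q : nat).
Variables (l : nat -> T -> nat -> R) (delta : nat -> R).
Hypotheses (sigma_gt0 : 0 < sigma) (kq : (k <= q)%N).
Hypothesis ml : forall N i, measurable_fun setT (fun w => l N w i).
Hypothesis delta0 : delta @ \oo --> 0.
Hypothesis Ndelta : N%:R `^ (2 / 3) * delta N @[N --> \oo] --> +oo.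

Lemma near_delta_gt0 : \forall N \near \oo, 0 < delta N.
Proof.
move/cvgryPgt : Ndelta => /(_ 0); apply: filterS => N.
case: (N =P 0%N) => [->|/eqP N0]; first by rewrite powR0 ?mul0r ?ltxx.
by rewrite pmulr_rgt0// powR_gt0// ltr0n lt0n.
Qed.

Lemma near_delta_lt (e : R) : 0 < e -> \forall N \near \oo, delta N < e.
Proof.
move=> e0; move/cvgrPdist_lt : delta0 => /(_ e e0); apply: filterS => N.
by rewrite sub0r normrN; exact/le_lt_trans/ler_norm.
Qed.

Lemma cvgy_mul_delta : N%:R * delta N @[N --> \oo] --> +oo.
Proof.
apply/cvgryPge => A; move/cvgryPge : Ndelta => /(_ A).
apply: filterS3 near_delta_gt0 (nbhs_infty_gt 0) => N d0 N0.
move=> /le_trans; apply; rewrite ler_pM2r//.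
rewrite -[leRHS]powRr1// ler_powR ?ler1n//; lra.
Qed.

Lemma near_scaled_delta_gt (c A : R) : 0 < c ->
  \forall N \near \oo, A < c * (N%:R * delta N).
Proof.
move=> c0; move/cvgryPgt : cvgy_mul_delta => /(_ (A / c)).
by apply: filterS => N; rewrite ltr_pdivrMr// [_ * c]mulrC.
Qed.

(** The limit exceeds the edge because [psi sigma x - 2 * sigma = (x - sigma) ^+ 2 / x]. Half of
    this gap is kept as margin, and its square eventually dominates [c * delta N]. *)
Lemma whp_spike_large (i : nat) (x : R) : sigma < x ->
  {ae P, forall w, (fun N => l N w i) @ \oo --> psi sigma x} ->
  forall c, 0 < c ->
    whp P (fun N w => 4 * sigma ^+ 2 + c * delta N < l N w i ^+ 2).
Proof.
move=> sx li c c0.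
have x0 : 0 < x := lt_trans sigma_gt0 sx.
pose e := (psi sigma x - 2 * sigma) / 2.
have e0 : 0 < e.
  rewrite divr_gt0// /psi.
  rewrite (_ : _ - _ = (x - sigma) ^+ 2 / x); last by field; rewrite gt_eqF.
  by rewrite divr_gt0// exprn_gt0// subr_gt0.
have := whp_ae_cvg P (fun N w => l N w i) _ (ml^~ i) li e e0.
apply: whpS; near=> N => w.
have de : c * delta N < e ^+ 2.
  rewrite mulrC -ltr_pdivlMr//; near: N.
  by apply: near_delta_lt; rewrite divr_gt0// exprn_gt0.
rewrite ltr_norml => /andP[le _].
have : 2 * sigma + e < l N w i by move: le; rewrite /e; lra.
move: de; move: (delta N) (l N w i) => D y de ey.
have se0 : 0 < 2 * sigma + e by apply: addr_gt0 => //; exact: mulr_gt0.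
have : (2 * sigma + e) ^+ 2 < y ^+ 2.
  by rewrite ltr_sqr ?nnegrE ?(ltW se0)// ltW// (lt_trans se0).
by have := mulr_gt0 sigma_gt0 e0; nra.
Unshelve. all: by end_near. Qed.

(** Tightness at the level [sigma / 16 * N^(2/3) * delta N] gives [l N w i <= 2 * sigma + sigma / 16
    * delta N]. Squaring adds [sigma ^+ 2] times [delta / 4 + delta ^ 2 / 256], which is below
    [delta / 2] once [delta < 1]. *)
Lemma whp_bulk_edge (i : nat) (F : R -> R) :
  {ae P, forall w, (fun N => l N w i) @ \oo --> 2 * sigma} ->
  continuous_cdf F ->
  (forall x, P [set w | N%:R `^ (2 / 3) * (l N w i - 2 * sigma) <= x]
     @[N --> \oo] --> (F x)%:E) ->
  whp P (fun N w => l N w i ^+ 2 <= 4 * sigma ^+ 2 + sigma ^+ 2 * delta N / 2).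
Proof.
move=> li [_ [_ [_ F1]]] liF.
have s16 : 0 < sigma / 16 by rewrite divr_gt0.
have := whp_tight P (fun N w => N%:R `^ (2 / 3) * (l N w i - 2 * sigma)) F
  (fun N => sigma / 16 * (N%:R `^ (2 / 3) * delta N)).
move=> /(_ _ liF F1 _)[].
- by move=> N; apply: measurable_funM => //; exact: measurable_funB.
- apply/cvgryPge => A; move/cvgryPge : Ndelta => /(_ (A / (sigma / 16))).
  by apply: filterS => N; rewrite ler_pdivrMr// [_ * (sigma / 16)]mulrC.
(* Almost sure convergence supplies [l N w i > 0], without which the upper bound could not be
   squared. *)
move=> C hC; have := whpI P _ _ (ex_intro _ C hC)
  (whp_ae_cvg P (fun N w => l N w i) _ (ml^~ i) li _ sigma_gt0).
apply: whpS; near=> N => w.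
have d0 : 0 < delta N by near: N; exact: near_delta_gt0.
have d1 : delta N < 1 by near: N; exact: near_delta_lt.
have N0 : 0 < N%:R `^ (2 / 3) :> R.
  by rewrite powR_gt0// ltr0n; near: N; exact: nbhs_infty_gt.
rewrite mulrCA ler_pM2l// ltr_norml => -[lu /andP[ll _]].
move: d0 d1 lu ll; move: (delta N) (l N w i) => D y d0 d1 lu ll.
have y0 : 0 < y by have := sigma_gt0; lra.
have : y ^+ 2 <= (2 * sigma + sigma / 16 * D) ^+ 2.
  have b0 : 0 <= 2 * sigma + sigma / 16 * D by rewrite ltW// (lt_le_trans y0)//; lra.
  by rewrite ler_sqr ?nnegrE ?(ltW y0)//; lra.
have s2 : 0 < sigma ^+ 2 by rewrite exprn_gt0.
rewrite (_ : (2 * sigma + sigma / 16 * D) ^+ 2 =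
  4 * sigma ^+ 2 + sigma ^+ 2 * (D / 4 + D ^+ 2 / 256)); last by field.
move=> /le_trans; apply; rewrite lerD2l -mulrA ler_pM2l//; nra.
Unshelve. all: by end_near. Qed.

(** A convergent eigenvalue is bounded while [N * delta N] diverges; this makes finitely many top
    eigenvalues negligible in the trace. *)
Lemma whp_sqr_small (i : nat) (a : R) :
  {ae P, forall w, (fun N => l N w i) @ \oo --> a} ->
  forall c, 0 < c -> whp P (fun N w => l N w i ^+ 2 <= c * (N%:R * delta N)).
Proof.
move=> li c c0.
have := whp_ae_cvg P (fun N w => l N w i) _ (ml^~ i) li 1 ltr01.
apply: whpS; near=> N => w la.
have : `|l N w i| <= `|a| + 1.
  rewrite -[l N w i](subrK a) (le_trans (ler_normD _ _))// addrC.
  by rewrite lerD2l ltW.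
move=> lN; apply: (@le_trans _ _ ((`|a| + 1) ^+ 2)).
  by rewrite -[leLHS]real_normK ?num_real// ler_sqr ?nnegrE// addr_ge0.
by apply/ltW; near: N; exact: near_scaled_delta_gt.
Unshelve. all: by end_near. Qed.

(** Treats both scores at once: [s] stands for [sigma ^+ 2] or for its estimate, and [score_argmin]
    is applied with [eta = delta N / 2]. *)
Lemma whp_khat (s F : nat -> nat -> T -> R) :
  (forall i, (i < k)%N -> forall c, 0 < c ->
    whp P (fun N w => 4 * sigma ^+ 2 + c * delta N < l N w i ^+ 2)) ->
  (forall i, (k <= i)%N -> (i < q)%N ->
    whp P (fun N w => l N w i ^+ 2 <= 4 * sigma ^+ 2 + sigma ^+ 2 * delta N / 2)) ->
  (forall j, (j <= q)%N -> forall c, 0 < c ->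
    whp P (fun N w => `|s N j w - sigma ^+ 2| <= c * delta N)) ->
  whp P (fun N w => forall j, (j <= q)%N ->
    N%:R / (2 * s N j w) * (tail_sq N j (l N w) - tail_sq N k (l N w)) +
    (2 + delta N) * (npar R N j - npar R N k) <= F N j w - F N k w) ->
  whp P (fun N w => khat q (F N ^~ w) = k).
Proof.
move=> hspike hedge hs hgap.
have s2 : 0 < sigma ^+ 2 by rewrite exprn_gt0.
(* The coefficient 3 leaves room for [2 * (2 + D) * (S + S / 16 * D)], which is
   [4 * S + 9 / 4 * S * D] plus a term of order [D ^ 2]. *)
have hspike' := whp_all P k _ (fun i ik => hspike i ik _ (mulr_gt0 (ltr0n R 3) s2)).
have hedge' : whp P (fun N w => forall i, (i < q)%N -> (k <= i)%N ->
    l N w i ^+ 2 <= 4 * sigma ^+ 2 + sigma ^+ 2 * delta N / 2).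
  apply: (whp_all P q (fun i N w => (k <= i)%N ->
    l N w i ^+ 2 <= 4 * sigma ^+ 2 + sigma ^+ 2 * delta N / 2)) => i iq.
  have [ki|ik] := leqP k i; last by apply/whp_near/nearW.
  by apply: whpS (hedge i ki iq); apply: nearW.
(* With this precision on [s], the overfitting threshold is at least [4 * S + 3 / 4 * S * D] up to
   order [D ^ 2], above the edge bound with [S * D / 2]. *)
have s16 : 0 < sigma ^+ 2 / 16 by rewrite divr_gt0.
have hs' := whp_all P q.+1 _ (fun j jq => hs j jq _ s16).
apply: whpS (whpI P _ _ (whpI P _ _ hspike' hedge') (whpI P _ _ hs' hgap)).
near=> N => w [[Nspike Nedge] [Ns Ngap]].
have d0 : 0 < delta N by near: N; exact: near_delta_gt0.
have d1 : delta N < 1 by near: N; exact: near_delta_lt.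
have qN : (q < N)%N by near: N; exact: nbhs_infty_gt.
(* The 3 bounds [gamma = 2 + delta N]. *)
have Nd : 3 * q%:R ^+ 2 < 1 / 2 * (N%:R * delta N).
  by near: N; apply: near_scaled_delta_gt.
apply: khat_eq => //.
apply: (score_argmin N q k (l N w) kq qN (2 + delta N) (delta N / 2) (s N ^~ w)) => //.
- by rewrite addr_gt0.
- rewrite (_ : N%:R * (delta N / 2) = 1 / 2 * (N%:R * delta N)); last by ring.
  apply: le_lt_trans Nd; apply: ler_wpM2r; first exact: sqr_ge0.
  by move: d1; lra.
- move=> j jq; have := Ns j jq; rewrite ler_norml => /andP[+ _].
  by move: s2 d0 d1; move: (sigma ^+ 2) (delta N) (s N j w) => S D x; nra.
- move=> i j jq /andP[ji ik]; apply: le_lt_trans (Nspike i ik).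
  have := Ns j jq; rewrite ler_norml => /andP[_].
  move: s2 d0 d1; move: (sigma ^+ 2) (delta N) (s N j w) => S D x S0 D0 D1 xS.
  apply: (@le_trans _ _ (2 * (2 + D) * (S + S / 16 * D))).
    by apply: ler_wpM2l; [rewrite mulr_ge0// addr_ge0// ltW|lra].
  rewrite -subr_ge0 (_ : _ - _ = S * D * (6 - D) / 8); last by field.
  by rewrite divr_ge0// mulr_ge0 ?mulr_ge0 ?(ltW S0) ?(ltW D0)//; lra.
- move=> i j jq /andP[ki ij]; apply: le_trans (Nedge i (leq_trans ij jq) ki) _.
  have := Ns j jq; rewrite ler_norml => /andP[+ _].
  move: s2 d0 d1; move: (sigma ^+ 2) (delta N) (s N j w) => S D x S0 D0 D1 xS.
  apply: (@le_trans _ _ (2 * (S - S / 16 * D) * (2 + D - D / 2))).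
    rewrite -subr_ge0 (_ : _ - _ = S * D * (4 - D) / 16); last by field.
    by rewrite divr_ge0// mulr_ge0 ?mulr_ge0 ?(ltW S0) ?(ltW D0)//; lra.
  by apply: ler_wpM2r; lra.
Unshelve. all: by end_near. Qed.

(** The error in the numerator has three sources: the fluctuation of the trace, the shift [K], and
    the [j] removed eigenvalues. Each is allotted [c / 3 * (N * delta N)]. *)
Lemma whp_tail_sq (K : R) (j : nat) : (j <= q)%N ->
  (forall i, (i < q)%N -> exists a : R,
     {ae P, forall w, (fun N => l N w i) @ \oo --> a}) ->
  (forall c, 0 < c -> whp P (fun N w =>
     `|tail_sq N 0 (l N w) - (K + sigma ^+ 2 * (N%:R + 1))| < c * (N%:R * delta N))) ->
  forall c, 0 < c -> whp P (fun N w =>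
    `|sigma2_hat N j (l N w) - sigma ^+ 2| <= c * delta N).
Proof.
move=> jq lcvg htr c c0.
have c30 : 0 < c / 3 by rewrite divr_gt0.
(* At most [q] eigenvalues share this allotment; [q + 1] keeps the divisor positive when [q] is
   0. *)
pose c' := c / 3 / (q%:R + 1).
have c'0 : 0 < c' by rewrite divr_gt0// ltr_wpDl.
have hsmall := whp_all P j (fun i N w => l N w i ^+ 2 <= c' * (N%:R * delta N))
  (fun i ij => let: ex_intro a la := lcvg i (leq_trans ij jq) in
     whp_sqr_small i a la c' c'0).
apply: whpS (whpI P _ _ hsmall (htr _ c30)).
near=> N => w [Nsmall]; rewrite ltr_norml => /andP[tr1 tr2].
have d0 : 0 < delta N by near: N; exact: near_delta_gt0.
have jN : (j <= N)%N by near: N; exact: nbhs_infty_ge.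
have NK : `|K| < c / 3 * (N%:R * delta N) by near: N; exact: near_scaled_delta_gt.
have N1 : 0 < N%:R + 1 :> R by rewrite ltr_wpDl.
have := @tail_sqB _ N (l N w) 0 j (leq0n j) jN.
have : 0 <= \sum_(0 <= m < j) l N w m ^+ 2.
  by apply: sumr_ge0 => m _; exact: sqr_ge0.
have : \sum_(0 <= m < j) l N w m ^+ 2 <= c / 3 * (N%:R * delta N).
  apply: (@le_trans _ _ (\sum_(0 <= m < j) c' * (N%:R * delta N))).
    by rewrite big_nat [leRHS]big_nat; apply: ler_sum => m; exact: Nsmall.
  rewrite sumr_const_nat subn0 -[leLHS]mulr_natr mulrAC; apply: ler_wpM2r.
    by rewrite mulr_ge0// ltW.
  rewrite /c' mulrAC ler_pdivrMr ?ltr_wpDl// ler_pM2l//.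
  by rewrite (@le_trans _ _ q%:R) ?ler_nat// lerDl.
move: NK; rewrite ltr_norml => /andP[K1 K2] S1 S2 SE.
rewrite /sigma2_hat (_ : _ - _ =
  (tail_sq N j (l N w) - sigma ^+ 2 * (N%:R + 1)) / (N%:R + 1)); last first.
  by field; rewrite gt_eqF.
rewrite normrM normfV [`|N%:R + 1|]gtr0_norm// ler_pdivrMr// ler_norml.
have : 0 < c * delta N by rewrite mulr_gt0.
have -> : tail_sq N j (l N w) = tail_sq N 0 (l N w) - \sum_(0 <= m < j) l N w m ^+ 2.
  by rewrite -SE opprB addrC subrK.
rewrite (_ : c * delta N * (N%:R + 1) =
  3 * (c / 3 * (N%:R * delta N)) + c * delta N); last by field.
by move=> ?; apply/andP; split; lra.
Unshelve. all: by end_near. Qed.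

(** Chebyshev's bound with [V] independent of [N], at a level [E] proportional to [N * delta N]:
    once [E > 1] and [E > V / e], the bound [V / E ^+ 2] is at most [e]. *)
Lemma whp_GOE_trace (V K : R) (X : nat -> T -> R) :
  (forall N, measurable_fun setT (X N)) ->
  (\forall N \near \oo, forall e, 0 < e ->
    (P [set w | (e <= `|X N w - (K + sigma ^+ 2 * (N%:R + 1))|)%R] <=
     (V / e ^+ 2)%:E)%E) ->
  forall c, 0 < c -> whp P (fun N w =>
     `|X N w - (K + sigma ^+ 2 * (N%:R + 1))| < c * (N%:R * delta N)).
Proof.
move=> mX XV c c0.
pose D N := [set w | c * (N%:R * delta N) <= `|X N w - (K + sigma ^+ 2 * (N%:R + 1))|].
exists D; split.
- move=> N; apply: measurable_le_set => //.
  by apply: measurableT_comp => //; exact: measurable_funB.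
- apply: cvge0_prob => [N|e e0].
    apply: measurable_le_set => //.
    by apply: measurableT_comp => //; exact: measurable_funB.
  near=> N.
  have E1 : 1 < c * (N%:R * delta N) by near: N; exact: near_scaled_delta_gt.
  have EV : V / e < c * (N%:R * delta N) by near: N; exact: near_scaled_delta_gt.
  have : forall e, 0 < e ->
    (P [set w | (e <= `|X N w - (K + sigma ^+ 2 * (N%:R + 1))|)%R] <=
     (V / e ^+ 2)%:E)%E by near: N.
  move=> /(_ _ (lt_trans ltr01 E1)) /le_trans; apply; rewrite lee_fin.
  move: E1 EV; move: (c * _) => E E1; rewrite ltr_pdivrMr// => EV.
  rewrite ler_pdivrMr; last by rewrite exprn_gt0// (lt_trans ltr01).
  apply: (le_trans (ltW EV)); rewrite mulrC ler_pM2l//.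
  by rewrite expr2 ler_peMr// ltW// (lt_trans ltr01).
- by apply: nearW => N w /negP; rewrite -ltNge.
Unshelve. all: by end_near. Qed.

End consistency.

Theorem theorem2p2
  (R : realType) (d : measure_display) (T : measurableType d)
  (P : probability T R)
  (sigma : R) (k q : nat) (lam : nat -> R)
  (u : forall N : nat, nat -> 'cV[R]_N)
  (G : forall N : nat, T -> 'M[R]_N)
  (l : nat -> T -> nat -> R)
  (C : nat -> R) (delta : nat -> R) (TW : nat -> R -> R) :
  0 < sigma ->
  (k <= q)%N ->
  (forall i : nat, (i.+1 < k)%N -> lam i.+1 <= lam i) ->
  (forall i : nat, (i < k)%N -> sigma < lam i) ->
  (forall N : nat, (k <= N)%N -> orthonormal_family k (u N)) ->
  (forall N : nat, GOE_matrix P (G N)) ->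
  (forall (N : nat) (w : T),
     is_ordered_spectrum (spike_matrix k lam (u N) + sigma *: G N w) (l N w)) ->
  (forall (N i : nat), measurable_fun setT (fun w => l N w i)) ->
  (* spiked eigenvalues *)
  (forall i : nat, (i < k)%N ->
     {ae P, forall w, (fun N : nat => l N w i) @ \oo --> psi sigma (lam i)}) ->
  (* non-spiked top eigenvalues *)
  (forall i : nat, (k <= i)%N -> (i < q)%N ->
     {ae P, forall w, (fun N : nat => l N w i) @ \oo --> 2 * sigma}) ->
  (* Tracy--Widom fluctuations: ell_{i+1} (1-based index i+1 > k) *)
  (forall m : nat, (0 < m)%N -> continuous_cdf (TW m)) ->
  (forall i : nat, (k <= i)%N -> forall x : R,
     (fun N : nat =>
        P [set w | N%:R `^ (2 / 3) * (l N w i - 2 * sigma) <= x])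
       @ \oo --> ((TW (i.+1 - k)%N x)%:E)) ->
  (forall N : nat, 0 < C N) ->
  delta @ \oo --> 0 ->
  (fun N : nat => N%:R `^ (2 / 3) * delta N) @ \oo --> +oo ->
  (fun N : nat =>
     P [set w | khat q (GAIC_known N (C N) sigma (2 + delta N) (l N w)) = k])
    @ \oo --> 1%E /\
  (fun N : nat =>
     P [set w | khat q (GAIC_unknown N (C N) (2 + delta N) (l N w)) = k])
    @ \oo --> 1%E.
Proof.
move=> sigma_gt0 kq _ lam_gt u_orth GOE_G spec ml lspike lbulk TW_cdf lTW _.
move=> delta0 Ndelta.
pose K := \sum_(i < k) lam i ^+ 2.
have lcvg i : (i < q)%N -> exists a : R,
    {ae P, forall w, (fun N => l N w i) @ \oo --> a}.
  move=> iq; have [ki|ik] := leqP k i; first by exists (2 * sigma); exact: lbulk.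
  by exists (psi sigma (lam i)); exact: lspike.
have trace c : 0 < c -> whp P (fun N w =>
    `|tail_sq N 0 (l N w) - (K + sigma ^+ 2 * (N%:R + 1))| < c * (N%:R * delta N)).
  apply: (whp_GOE_trace P sigma delta Ndelta
    (16 * sigma ^+ 2 * K + 464 * sigma ^+ 4) K (fun N w => tail_sq N 0 (l N w))).
    by move=> N; exact: measurable_tail_sq.
  near=> N => e e0.
  have N0 : (0 < N)%N by near: N; exact: nbhs_infty_gt.
  have kN : (k <= N)%N by near: N; exact: nbhs_infty_ge.
  have AT := @spike_matrix_sym R N k lam (u N).
  have AK := sum_sqr_spike_matrix N k lam (u N) (u_orth N kN).
  have := GOE_frobenius_concentration P N (G N) N0 (GOE_G N) _ sigma e AT e0.
  (* With [j = 0] the tail is the full sum of squared eigenvalues, hence the trace of the square,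
     hence the squared Frobenius norm, as the model matrix is symmetric. *)
  rewrite AK; congr (P _ <= _)%E; apply/seteqP; split => w /=;
    rewrite /tail_sq (sum_sqr_eigenvalues _ _ _ (spec N w).2) mxtrace_sqr_sym//;
    rewrite linearD linearZ/= AT; congr (_ + _ *: _); exact: (GOE_G N).1.
have sigma_hat := fun j jq => whp_tail_sq P sigma q l delta ml Ndelta K j jq lcvg trace.
have hspike i (ik : (i < k)%N) :=
  whp_spike_large P sigma l delta sigma_gt0 ml delta0 i (lam i)
    (lam_gt i ik) (lspike i ik).
have hedge i (ki : (k <= i)%N) (iq : (i < q)%N) :
    whp P (fun N w => l N w i ^+ 2 <= 4 * sigma ^+ 2 + sigma ^+ 2 * delta N / 2).
  apply: (whp_bulk_edge P sigma l delta sigma_gt0 ml delta0 Ndelta i (TW (i.+1 - k)%N)).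
  - exact: lbulk.
  - by apply: TW_cdf; rewrite subn_gt0.
  - exact: lTW.
split; apply: cvg_whp.
- by move=> N; apply: measurable_khat => j; exact: measurable_GAIC_known.
(* For known [sigma] the variance is exact, so its deviation is 0 and only [delta N > 0] is
   required. *)
- apply: (whp_khat P sigma k q l delta sigma_gt0 kq delta0 Ndelta
    (fun _ _ _ => sigma ^+ 2)
    (fun N j w => GAIC_known N (C N) sigma (2 + delta N) (l N w) j)) => //.
    move=> j jq c c0; apply: whp_near; near=> N => w.
    by rewrite subrr normr0 mulr_ge0// ltW//; near: N; exact: near_delta_gt0.
  by apply/whp_near/nearW => N w j jq; rewrite (GAIC_known_gap N k _ (C N)).
- by move=> N; apply: measurable_khat => j; exact: measurable_GAIC_unknown.
- apply: (whp_khat P sigma k q l delta sigma_gt0 kq delta0 Ndelta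
    (fun N j w => sigma2_hat N j (l N w))
    (fun N j w => GAIC_unknown N (C N) (2 + delta N) (l N w) j)) => //.
  have s2 : 0 < sigma ^+ 2 / 2 by rewrite divr_gt0// exprn_gt0.
  have := whp_all P q.+1 _ (fun j jq => sigma_hat j jq _ s2).
  apply: whpS; near=> N => w hs j jq.
  have d1 : delta N < 1 by near: N; exact: near_delta_lt.
  (* Closeness of the estimate to [sigma ^+ 2] makes the tails positive, as the logarithms in
     [GAIC_unknown_gap] require. *)
  have Spos i : (i <= q)%N -> 0 < tail_sq N i (l N w).
    move=> iq; have := hs i iq; rewrite ler_norml => /andP[+ _].
    rewrite /sigma2_hat => h.
    have : 0 < tail_sq N i (l N w) / (N%:R + 1) by move: h s2 d1; nra.
    by rewrite pmulr_lgt0// invr_gt0 ltr_wpDl.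
  by apply: GAIC_unknown_gap; exact: Spos.
Unshelve. all: by end_near. Qed.
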